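(* Let $(I_n)_{n\in\mathbb N}$ be a sequence of operators $I_n\colon C_\kappa(X_n)\to C_\kappa(X_n)$ such that: (1) $I_n$ is convex and monotone with $I_n0=0$ for all $n\in\mathbb N$. (2) There exists $\omega\ge0$ with $\|I_nf-I_ng\|_{\kappa,X_n}\le e^{\omega h_n}\|f-g\|_{\kappa,X_n}$ for all $n\in\mathbb N$ and $f,g\in C_\kappa(X_n)$. (3) For every $\epsilon>0$, $r,T\ge0$ and $K\Subset\mathbb R^d$ there exist $c\ge0$ and $K'\Subset\mathbb R^d$ with $\|I_n^kf-I_n^kg\|_{\infty,K_n}\le c\|f-g\|_{\infty,K_n'}+\epsilon$ for all $k,n\in\mathbb N$ with $kh_n\le T$ and $f,g\in B_{C_\kappa(X_n)}(r)$. (4) $I_n\colon\mathrm{Lip}_b(X_n,r)\to\mathrm{Lip}_b(X_n,e^{\omega h_n}r)$ for all $r\ge0$ and $n\in\mathbb N$ (same $\omega$). (5) There exists a countable set $\mathcal D_0\subset\mathrm{Lip}_b(\mathbb R^d)$ such that for every $f\in\mathcal D_0$ there exist $r\ge0$ and $\bar f_n\in\mathrm{Lip}_b(X_n,r)$ with $\bar f_n\to f$ and $\|\bar f_n\|_{\kappa,X_n}\le\|f\|_\kappa$ for all $n$ such that the limit $\lim_{n\to\infty}\frac{I_n\bar f_n-\bar f_n}{h_n}\in C_\kappa(\mathbb R^d)$ exists. Moreover, for every $f\in C_\kappa(\mathbb R^d)$ there exists $(f_n)\subset\mathcal D_0$ with $f_n\to f$ and $\|f_n\|_\kappa\le\|f\|_\kappa$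 for all $n$. Then there exist a strongly continuous convex monotone semigroup $(S(t))_{t\ge0}$ on $C_\kappa(\mathbb R^d)$ with generator $A\colon D(A)\to C_\kappa(\mathbb R^d)$ and a subsequence $(n_l)_{l\in\mathbb N}\subset\mathbb N$ with $$S(t)f=\lim_{l\to\infty}I_{n_l}^{k^t_{n_l}}f_{n_l}\quad\text{for all }(f,t)\in C_\kappa(\mathbb R^d)\times\mathbb R_+,$$ where $k_n^t\in\mathbb N$ with $k_n^th_n\to t$ and $f_n\in C_\kappa(X_n)$ with $f_n\to f$ are arbitrary. Moreover: (i) For every $f\in C_\kappa(\mathbb R^d)$ and $f_n\in C_\kappa(X_n)$ such that $f_n\to f$ and the limit $g:=\lim_{n\to\infty}\frac{I_nf_n-f_n}{h_n}$ exists (in $C_\kappa(\mathbb R^d)$), it holds $f\in D(A)$ and $Af=g$. (ii) $\|S(t)f-S(t)g\|_\kappa\le e^{\omega t}\|f-g\|_\kappa$ for all $t\ge0$ and $f,g\in C_\kappa(\mathbb R^d)$. (iii) For every $\epsilon>0$, $r,T\ge0$ and $K\Subset\mathbb R^d$ there exist $c\ge0$ and $K'\Subset\mathbb R^d$ with $\|S(t)f-S(t)g\|_{\infty,K}\le c\|f-g\|_{\infty,K'}+\epsilon$ for all $t\in[0,T]$ and $f,g\in B_{C_\kappa(\mathbb R^d)}(r)$. (iv) $S(t)\colon\mathrm{Lip}_b(\mathbb R^d,r)\to\mathrm{Lip}_b(\mathbb R^d,e^{\omega t}r)$ for all $r,t\ge0$.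
   Context: Fix $d\in\mathbb N$ and a bounded continuous $\kappa:\mathbb R^d\to(0,\infty)$ with $\sup_{x\in\mathbb R^d}\sup_{|y|\le1}\kappa(x)/\kappa(x-y)<\infty$. For $X\subset\mathbb R^d$, $C_\kappa(X)$ is the space of continuous $f:X\to\mathbb R$ with $\|f\|_{\kappa,X}:=\sup_{x\in X}|f(x)|\kappa(x)<\infty$; $\|\cdot\|_\kappa:=\|\cdot\|_{\kappa,\mathbb R^d}$; $B_{C_\kappa(X)}(r):=\{f\in C_\kappa(X):\|f\|_{\kappa,X}\le r\}$; $\|f\|_{\infty,K}:=\sup_{x\in K}|f(x)|$; $K\Subset X$ means that $K$ is a compact subset of $X$. $C_\kappa(X)$ carries the mixed topology, the strongest locally convex topology coinciding on $\|\cdot\|_{\kappa,X}$-bounded sets with the topology of uniform convergence on compact subsets; for sequences, $f_n\to f$ iff $\sup_n\|f_n\|_{\kappa,X}<\infty$ and $\|f-f_n\|_{\infty,K}\to0$ for all $K\Subset X$. All limits in $C_\kappa(X)$ refer to this topology. $f\le g$ is pointwise, and $f_n\downarrow f$ means that $f_n$ decreases pointwise to $f$. An operator $S:C_\kappa(X)\to C_\kappa(X)$ is monotone if $f\le g$ implies $Sf\le Sg$, and convex if $S(\lambda f+(1-\lambda)g)\le\lambda Sf+(1-\lambda)Sg$ for $\lambda\in[0,1]$. $\mathbb R_+:=[0,\infty)$. $\mathrm{Lip}_b(X)$: bounded Lipschitz functions $X\to\mathbb R$; $\mathrm{Lip}_b(X,r)$: $r$-Lipschitz functions $f:X\to\mathbb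 R$ with $\sup|f|\le r$. A strongly continuous convex monotone semigroup on $C_\kappa(\mathbb R^d)$ is a family $(S(t))_{t\ge0}$ of operators on $C_\kappa(\mathbb R^d)$ such that: each $S(t)$ is convex and monotone with $S(t)f_n\downarrow0$ whenever $f_n\downarrow0$; $S(0)f=f$ and $S(s+t)f=S(s)S(t)f$; $\sup_{t\in[0,T]}\|S(t)\frac r\kappa\|_{\kappa}<\infty$ for all $r,T\ge0$; $\lim_{t\downarrow0}S(t)f=f$ for all $f$. Its generator is $Af:=\lim_{h\downarrow0}\frac{S(h)f-f}h$ with domain $D(A)$ the set of $f\in C_\kappa(\mathbb R^d)$ for which this limit exists in $C_\kappa(\mathbb R^d)$. $(h_n)\subset(0,\infty)$ is a fixed sequence with $h_n\to0$. $(X_n)$ is a sequence of closed sets $X_n\subset\mathbb R^d$ with $x+y\in X_n$ for all $x,y\in X_n$ such that for every $x\in\mathbb R^d$ there exist $x_n\in X_n$ with $x_n\to x$. For $K\Subset\mathbb R^d$ put $K_n:=K\cap X_n$. For $f_n\in C_\kappa(X_n)$ and $f\in C_\kappa(\mathbb R^d)$, $f_n\to f$ (or $f=\lim f_n$) means $\sup_n\|f_n\|_{\kappa,X_n}<\infty$ and $\|f-f_n\|_{\infty,K_n}\to0$ for all $K\Subset\mathbb R^d$ with $K\cap X_n\ne\emptyset$ for all $n$ (similarly along subsequences). $I_n^k$ is the $k$-fold composition of $I_n$. *)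

(* Defs.v *)
From HB Require Import structures.
From mathcomp Require Import all_boot all_order all_algebra.
From mathcomp Require Import all_classical all_reals all_analysis.

Set Implicit Arguments.
Unset Strict Implicit.
Unset Printing Implicit Defensive.

Import Order.TTheory GRing.Theory Num.Theory.
Import numFieldNormedType.Exports.

Local Open Scope classical_set_scope.
Local Open Scope ring_scope.

(* A function X -> R on a subset X of R^d is represented by a total function
   on R^d of which only the values on X matter: every notion below that
   takes a set X depends only on the restrictions to X of the functions
   involved (for operators this is [op_ext]). *)

Section Spaces.
Context {R : realType} {d : nat}.
Local Notation V := 'rV[R]_d.
Implicit Types (kappa f g : V -> R) (X K : set V).

(* Euclidean norm; the library's norm on 'rV[R]_d is the maximum norm. *)
Definition enorm (x : V) : R := Num.sqrt (\sum_i x ord0 i ^+ 2).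

Record weight kappa : Prop := Weight {
  weight_gt0 : forall x, 0 < kappa x;
  weight_bounded : exists M : R, forall x, kappa x <= M;
  weight_continuous : continuous kappa;
  weight_shift : exists M : R, forall x y : V, enorm y <= 1 ->
    kappa x / kappa (x - y) <= M }.

(* The real [sup] is 0 on the empty set, and also on sets that are not bounded
   above; the latter does not occur for f in [Ckappa kappa X], resp. for f
   continuous on a compact K. *)
Definition knorm kappa X f : R := sup [set `|f x| * kappa x | x in X].

Definition supnorm K f : R := sup [set `|f x| | x in K].

Definition Ckappa kappa X : set (V -> R) :=
  [set f | {within X, continuous f} /\
           exists M : R, forall x, X x -> `|f x| * kappa x <= M].

Definition Cball kappa X (r : R) : set (V -> R) :=
  [set f | Ckappa kappa X f /\ knorm kappa X f <= r].

Definition lipschitz_with (L : R) X f :=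
  forall x y, X x -> X y -> `|f x - f y| <= L * enorm (x - y).

Definition Lip_b X : set (V -> R) :=
  [set f | (exists L : R, lipschitz_with L X f) /\
           exists M : R, forall x, X x -> `|f x| <= M].

Definition Lip_br X (r : R) : set (V -> R) :=
  [set f | lipschitz_with r X f /\ forall x, X x -> `|f x| <= r].

(* Convergence f_n -> f of f_n in Ckappa (X n) to f in Ckappa (R^d). *)
Definition cvg_along kappa (X : nat -> set V) (fn : nat -> V -> R) f :=
  (exists M : R, forall n, knorm kappa (X n) (fn n) <= M) /\
  forall K, compact K -> (forall n, K `&` X n !=set0) ->
    supnorm (K `&` X n) (f - fn n) @[n --> \oo] --> (0 : R).

Record operator_on kappa X (I : (V -> R) -> V -> R) : Prop := OperatorOn {
  op_maps : forall f, Ckappa kappa X f -> Ckappa kappa X (I f);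
  op_ext : forall f g, Ckappa kappa X f -> Ckappa kappa X g ->
    (forall x, X x -> f x = g x) -> forall x, X x -> I f x = I g x }.

Definition monotone_op kappa X (I : (V -> R) -> V -> R) :=
  forall f g, Ckappa kappa X f -> Ckappa kappa X g ->
    (forall x, X x -> f x <= g x) -> forall x, X x -> I f x <= I g x.

Definition convex_op kappa X (I : (V -> R) -> V -> R) :=
  forall f g (l : R), Ckappa kappa X f -> Ckappa kappa X g -> 0 <= l <= 1 ->
    forall x, X x ->
      I (l *: f + (1 - l) *: g) x <= l * I f x + (1 - l) * I g x.

End Spaces.

Section Topology.
Context {R : realType} {d : nat}.
Local Notation V := 'rV[R]_d.
Implicit Types (E U W B : set (V -> R)) (tau : set (set (V -> R))).

(* tau is the family of open sets of a locally convex vector topology on the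
   linear subspace E of V -> R. *)
Record lc_topology E tau : Prop := LcTopology {
  lc_sub : forall U, tau U -> U `<=` E;
  lc_all : tau E;
  lc_cap : forall U W, tau U -> tau W -> tau (U `&` W);
  lc_cup : forall C : set (set (V -> R)), C `<=` tau ->
    tau (\bigcup_(U in C) U);
  lc_add : forall (f g : V -> R) U, E f -> E g -> tau U -> U (f + g) ->
    exists U1 U2 : set (V -> R), [/\ tau U1, tau U2, U1 f, U2 g &
      forall f' g' : V -> R, U1 f' -> U2 g' -> U (f' + g')];
  lc_scale : forall (a : R) (f : V -> R) U, E f -> tau U -> U (a *: f) ->
    exists (e : R) (U1 : set (V -> R)), [/\ 0 < e, tau U1, U1 f &
      forall (b : R) (f' : V -> R), `|b - a| < e -> U1 f' -> U (b *: f')];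
  lc_convex : forall (f : V -> R) U, tau U -> U f ->
    exists W : set (V -> R), [/\ tau W, W f, W `<=` U &
      forall (g h : V -> R) (l : R), W g -> W h -> 0 <= l <= 1 ->
        W (l *: g + (1 - l) *: h)] }.

(* Open subsets of E for the topology of uniform convergence on compact sets. *)
Definition co_open E U :=
  U `<=` E /\
  forall f, U f -> exists (K : set V) (e : R), [/\ compact K, 0 < e &
    forall g, E g -> supnorm K (g - f) < e -> U g].

Definition coincide_on B tau1 tau2 :=
  [set U `&` B | U in tau1] = [set U `&` B | U in tau2].

Definition kbounded (kappa : V -> R) B :=
  exists r : R, B `<=` Cball kappa setT r.

(* The strongest locally convex topology on Ckappa (R^d) that coincides with
   [co_open] on norm-bounded sets: as this topology exists, its open sets are
   the sets open for at least one topology with these two properties. *)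
Definition mixed_open (kappa : V -> R) U :=
  exists tau, [/\ lc_topology (Ckappa kappa setT) tau,
    forall B, kbounded kappa B ->
      coincide_on B tau (co_open (Ckappa kappa setT)) & tau U].

Definition mixed_cvg (kappa : V -> R) {T : Type} (F : set_system T)
    (u : T -> V -> R) (f : V -> R) :=
  forall U, mixed_open kappa U -> U f -> \forall i \near F, U (u i).

End Topology.

Section Semigroups.
Context {R : realType} {d : nat}.
Local Notation V := 'rV[R]_d.
Implicit Types (kappa f g : V -> R) (S : R -> (V -> R) -> V -> R).

Definition decreases_to (fn : nat -> V -> R) f :=
  (forall n x, fn n.+1 x <= fn n x) /\ forall x, fn n x @[n --> \oo] --> f x.

Record sc_convex_monotone_semigroup kappa S : Prop := Semigroup {
  sg_operator : forall t : R, 0 <= t -> operator_on kappa setT (S t);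
  sg_convex : forall t : R, 0 <= t -> convex_op kappa setT (S t);
  sg_monotone : forall t : R, 0 <= t -> monotone_op kappa setT (S t);
  sg_above : forall (t : R) (fn : nat -> V -> R), 0 <= t ->
    (forall n, Ckappa kappa setT (fn n)) -> decreases_to fn 0 ->
    decreases_to (fun n => S t (fn n)) 0;
  sg_0 : forall f, Ckappa kappa setT f -> S 0 f = f;
  sg_add : forall (s t : R) f, 0 <= s -> 0 <= t -> Ckappa kappa setT f ->
    S (s + t) f = S s (S t f);
  sg_bounded : forall r T : R, 0 <= r -> 0 <= T -> exists M : R, forall t,
    0 <= t <= T -> knorm kappa setT (S t (fun x => r / kappa x)) <= M;
  sg_continuous : forall f, Ckappa kappa setT f ->
    mixed_cvg kappa 0^'+ (fun t => S t f) f }.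

Definition generator_lim kappa S f g :=
  Ckappa kappa setT g /\
  mixed_cvg kappa 0^'+ (fun h : R => h^-1 *: (S h f - f)) g.

Definition generator_dom kappa S : set (V -> R) :=
  [set f | Ckappa kappa setT f /\ exists g, generator_lim kappa S f g].

Definition generator kappa S f : V -> R := xget 0 (generator_lim kappa S f).

End Semigroups.

(* Main.v *)
Require Import Defs.
From mathcomp Require Import all_boot all_order all_algebra.
From mathcomp Require Import all_classical all_reals all_analysis.
From mathcomp Require Import lra ring.

Set Implicit Arguments.
Unset Strict Implicit.
Unset Printing Implicit Defensive.

Import Order.TTheory GRing.Theory Num.Theory.
Import numFieldNormedType.Exports.

Local Open Scope classical_set_scope.
Local Open Scope ring_scope.

(** Why the theorem holds.

    The functions [I_n^k f] are controlled in three ways.  For [f] in the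
    countable set [D0], with approximants [fbar_n], they are Lipschitz in space
    with a constant depending only on a bound [T] for [k h_n], and Lipschitz in
    time, because one step moves [fbar_n] by [O(h_n)] and the iterates of [I_n]
    are Lipschitz for the weighted norm.  The assumed local equicontinuity of the iterates and the
    density of [D0] carry this over to all [f]: if [u_n -> f] and [v_n -> f],
    then [I_n^k u_n x] and [I_n^j v_n y] are close as soon as [n] is large and
    [|k h_n - j h_n|] and [|x - y|] are small ([equicontinuity]).

    Consequently everything converges once it converges for data in [D0], at
    rational times and near rational points.  These are countably many bounded
    real sequences, and a diagonal argument gives one subsequence along which
    all of them converge ([convergent_subsequence]).  Along it,
    [St t f x := lim I_n^k f x_n] with [k = floor (t / h_n)] exists, the
    convergence is uniform on compact sets, and the limit does not depend on the
    choices of [k], [f_n] and [x_n] ([St_lim], [St_loc]).  Convexity,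
    monotonicity, the Lipschitz estimates and the local equicontinuity pass to
    the limit; the semigroup law is the identity [I^(k+j) f = I^k (I^j f)]
    together with the freedom to use [I^j f] as approximants of [St t f];
    continuity from above follows from the theorem of Dini and the local
    equicontinuity.

    For the generator, put [q := (I_n u_n - u_n) / h_n], which converges to [g].
    Since [I_n u = h (u + q) + (1 - h) u] and [u = h (I_n u - q) + (1 - h) I_n u],
    convexity of the iterates gives
      [h (I^k (I u) - I^k (I u - q)) <= I^(k+1) u - I^k u <=
       h (I^k (u + q) - I^k u)].
    When [k h_n] is small, [I^k] is close to the identity on each of the four
    arguments, so both sides are [h (g + o(1))] ([increment_bounds]); summation
    over [k] yields [St t f - f = t g + o(t)] locally uniformly
    ([increment_estimate], [generator_limit]).

    The mixed topology enters only through its convergent bounded families.  The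
    topology of uniform convergence on compact sets is itself one of the
    topologies that define it, so mixed convergence implies locally uniform
    convergence; conversely a bounded, locally uniformly convergent family
    converges in each of these topologies ([mixed_cvg_supnorm],
    [mixed_cvg_bounded_loc]). *)

(** * Sup norms and pointwise bounds *)

Section PointwiseBounds.
Context {R : realType} {d : nat}.
Local Notation V := 'rV[R]_d.
Implicit Types (kappa f g : V -> R) (X K : set V).

(** Balls for the maximum norm serve as an exhaustion of [R^d] by compact sets:
    every statement about all compact [K] reduces to one about all radii. *)
Definition nball (rho : R) : set V := [set x | `|x| <= rho].

Lemma compact_nball (rho : R) : compact (nball rho).
Proof.
apply: bounded_closed_compact.
  exists rho; split; first exact: num_real.
  by move=> M rM x /= xr; rewrite (le_trans xr)// ltW.
have -> : nball rho = (fun x : V => `|x|) @^-1` [set y | y <= rho] by [].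
apply: preimage_closed; last exact: closed_le.
by move=> x _; exact: norm_continuous.
Qed.

Lemma compact_sub_nball K : compact K -> exists2 rho, 0 <= rho & K `<=` nball rho.
Proof.
move=> /compact_bounded[M [_ HM]]; exists (Num.max 0 (M + 1)).
  by rewrite le_max lexx.
move=> x Kx; apply: (le_trans (HM (M+1) _ x Kx)); first by rewrite ltrDl.
by rewrite le_max lexx orbT.
Qed.

Lemma continuous_bounded_on K f : compact K -> {within K, continuous f} ->
  exists2 M, 0 <= M & forall x, K x -> `|f x| <= M.
Proof.
move=> cK cf; have /compact_bounded[M [_ HM]] := continuous_compact cf cK.
exists (Num.max 0 (M + 1)); first by rewrite le_max lexx.
move=> x Kx; apply: (le_trans (HM (M+1) _ (f x) _)); first by rewrite ltrDl.
  by exists x.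
by rewrite le_max lexx orbT.
Qed.

Lemma weight_min kappa (rho : R) : weight kappa ->
  exists2 m, 0 < m & forall x, `|x| <= rho -> m <= kappa x.
Proof.
move=> [k0 _ kc _].
have [|M M0 HM] := @continuous_bounded_on (nball rho) (fun x => (kappa x)^-1)
   (@compact_nball rho).
  apply: continuous_subspaceT => x; apply: (@cvgV _ _ _ (nbhs_filter x)); [by rewrite gt_eqF|exact: kc].
exists (M + 1)^-1; first by rewrite invr_gt0 ltr_wpDl.
move=> x xr; have := HM x xr; rewrite ger0_norm; last by rewrite invr_ge0 ltW.
move=> kM; rewrite -[leRHS]invrK lef_pV2 ?posrE ?invr_gt0//.
- by rewrite (le_trans kM)// lerDl.
- by rewrite ltr_wpDl.
Qed.

Lemma enorm_continuous : continuous (@enorm R d).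
Proof.
move=> x; rewrite /enorm.
apply: (@continuous_comp _ _ _ (fun x : V => \sum_i x ord0 i ^+ 2) (@Num.sqrt R)).
  apply: (@continuous_big R 'I_d +%R 0 xpredT _ V _
    (fun i (y : V) => y ord0 i ^+ 2)); first exact: add_continuous.
  move=> i _ {}x.
  apply: (@continuous_comp _ _ _ (fun x : V => x ord0 i) (fun y => y ^+ 2)).
    exact: coord_continuous.
  exact: exprn_continuous.
exact: sqrt_continuous.
Qed.

(** Links the Euclidean norm, in which Lipschitz constants are measured, to the
    maximum norm, in which balls are taken. *)
Lemma enorm_small (eps : R) : 0 < eps ->
  exists2 del, 0 < del & forall x : V, `|x| <= del -> enorm x <= eps.
Proof.
move=> e0.
have e00 : @enorm R d 0 = 0.
  by rewrite /enorm big1 ?sqrtr0// => i _; rewrite mxE expr0n.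
have := @enorm_continuous 0; rewrite /continuous_at e00 => /cvgrPdist_le/(_ _ e0).
move=> /nbhs_ballP[del /= del0 H]; exists (del / 2); first by rewrite divr_gt0.
move=> x xd; have := H x; rewrite /= sub0r normrN (ger0_norm (sqrtr_ge0 _)).
apply; rewrite -ball_normE /= sub0r normrN (le_lt_trans xd)//.
by rewrite ltr_pdivrMr// ltr_pMr// ltr1n.
Qed.

Lemma supnorm_le K f (b : R) : 0 <= b -> (forall x, K x -> `|f x| <= b) ->
  supnorm K f <= b.
Proof.
move=> b0 H; rewrite /supnorm; have [->|/set0P[x Kx]] := eqVneq K set0.
  by rewrite image_set0 sup0.
apply: ge_sup; first by exists `|f x|, x.
by move=> _ [y Ky <-]; exact: H.
Qed.

(** The bound [b] certifies that the set is bounded above; without it the real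
    supremum is a default value and says nothing about [f]. *)
Lemma supnorm_ge K f (b : R) : (forall x, K x -> `|f x| <= b) ->
  forall x, K x -> `|f x| <= supnorm K f.
Proof.
move=> H x Kx; apply: ub_le_sup; last by exists x.
by exists b => _ [y Ky <-]; exact: H.
Qed.

Lemma sup_image_ge0 K f : (forall x, 0 <= f x) -> 0 <= sup [set f x | x in K].
Proof.
move=> f0; have [[[_ [x Kx _]] ub]|/sup_out->//] := pselect (has_sup [set f x | x in K]).
by apply: (le_trans (f0 x)); apply: ub_le_sup => //; exists x.
Qed.

Lemma supnorm_ge0 K f : 0 <= supnorm K f.
Proof. by apply: sup_image_ge0. Qed.

(** The inequality [knorm kappa X f <= b] freed from the default values of the
    real supremum. *)
Definition wle kappa X f (b : R) := forall x, X x -> `|f x| * kappa x <= b.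

Lemma knorm_le kappa X f (b : R) : 0 <= b -> wle kappa X f b ->
  knorm kappa X f <= b.
Proof.
move=> b0 H; rewrite /knorm; have [->|/set0P[x Kx]] := eqVneq X set0.
  by rewrite image_set0 sup0.
apply: ge_sup; first by exists (`|f x| * kappa x), x.
by move=> _ [y Ky <-]; exact: H.
Qed.

Lemma wle_knorm kappa X f : Ckappa kappa X f -> wle kappa X f (knorm kappa X f).
Proof.
move=> [_ [M HM]] x Xx; apply: ub_le_sup; last by exists x.
by exists M => _ [y Ky <-]; exact: HM.
Qed.

Lemma knorm_ge0 kappa X f : (forall x, 0 < kappa x) -> 0 <= knorm kappa X f.
Proof. by move=> k0; apply: sup_image_ge0 => x; rewrite mulr_ge0// ltW. Qed.

End PointwiseBounds.

(** * The mixed topology *)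

Section Mixed.
Context {R : realType} {d : nat} (kappa : 'rV[R]_d -> R) (wk : weight kappa).
Local Notation V := 'rV[R]_d.
Local Notation E := (Ckappa kappa setT).
Implicit Types (f g : V -> R) (X K : set V).

Lemma wleD X f g (b c : R) : wle kappa X f b -> wle kappa X g c ->
  wle kappa X (f + g) (b + c).
Proof.
move=> Hf Hg x Xx; apply: (le_trans _ (lerD (Hf x Xx) (Hg x Xx))).
by rewrite -mulrDl ler_wpM2r ?ler_normD// ltW// (weight_gt0 wk).
Qed.

Lemma wle_le X f (b c : R) : b <= c -> wle kappa X f b -> wle kappa X f c.
Proof. by move=> bc Hf x Xx; rewrite (le_trans (Hf x Xx)). Qed.

Lemma CkappaD X f g : Ckappa kappa X f -> Ckappa kappa X g ->
  Ckappa kappa X (f + g).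
Proof.
move=> [cf [M HM]] [cg [N HN]]; split.
  by move=> x; apply: (cvgD (cf x) (cg x)).
by exists (M + N); exact: wleD.
Qed.

Lemma CkappaZ X f (a : R) : Ckappa kappa X f -> Ckappa kappa X (a *: f).
Proof.
move=> [cf [M HM]]; split.
  by move=> x; apply: (cvgM (cvg_cst a) (cf x)).
exists (`|a| * M) => x Xx; rewrite [(a *: f) x]/(a * f x) normrM -mulrA.
by rewrite ler_wpM2l// HM.
Qed.

Lemma CkappaB X f g : Ckappa kappa X f -> Ckappa kappa X g ->
  Ckappa kappa X (f - g).
Proof. by move=> Ef Eg; rewrite -scaleN1r; apply: CkappaD => //; exact: CkappaZ. Qed.

Lemma Ckappa0 X : Ckappa kappa X 0.
Proof.
split; first by apply: continuous_subspaceT; exact: cst_continuous.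
by exists 0 => x _; rewrite normr0 mul0r.
Qed.

Lemma Ckappa_restrict X f : E f -> Ckappa kappa X f.
Proof.
move=> [cf [M HM]]; split; last by exists M => x _; exact: HM.
by apply: continuous_subspaceW cf => x.
Qed.

Lemma lipschitz_within_continuous X f (r : R) : 0 <= r ->
  lipschitz_with r X f -> {within X, continuous f}.
Proof.
move=> r0 Lf; apply/subspace_continuousP => x Xx; apply/cvgrPdist_le => e e0.
have p : 0 < r + 1 by rewrite ltr_wpDl.
have [del del0 Hdel] := @enorm_small R d (e / (r + 1)) (divr_gt0 e0 p).
apply/nbhs_ballP; exists del => //= y; rewrite -ball_normE /= => xy Xy.
rewrite (le_trans (Lf x y Xx Xy))// (le_trans (ler_wpM2l r0 (Hdel _ (ltW xy))))//.
by rewrite mulrCA ler_piMr ?(ltW e0)// ler_pdivrMr// mul1r lerDl.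
Qed.

Lemma Lip_br_Ckappa X f (r : R) : 0 <= r -> Lip_br X r f -> Ckappa kappa X f.
Proof.
move=> r0 [Lf Mf]; split; first exact: (lipschitz_within_continuous r0 Lf).
have [M HM] := weight_bounded wk.
by exists (r * M) => x Xx; rewrite ler_pM ?Mf// ltW// (weight_gt0 wk).
Qed.

(** A weighted bound is a uniform bound on each ball, because the weight is
    bounded away from 0 there. *)
Lemma wle_nball (rho : R) : exists2 C, 0 < C & forall X f (b : R),
  wle kappa X f b -> forall x, X x -> `|x| <= rho -> `|f x| <= C * b.
Proof.
have [m m0 Hm] := weight_min rho wk; exists m^-1; first by rewrite invr_gt0.
move=> X f b H x Xx xr; rewrite mulrC ler_pdivlMr//.
by rewrite (le_trans _ (H x Xx))// ler_wpM2l// Hm.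
Qed.

Lemma le_supnorm K f : compact K -> E f -> forall x, K x -> `|f x| <= supnorm K f.
Proof.
move=> /compact_sub_nball[rho _ Krho] [_ [M HM]] x.
have [C _ HC] := wle_nball rho.
by apply: (@supnorm_ge _ _ _ _ (C * M)) => {}x /Krho; exact: (HC setT _ _ HM).
Qed.

Lemma supnormD K f g : compact K -> E f -> E g ->
  supnorm K (f + g) <= supnorm K f + supnorm K g.
Proof.
move=> cK Ef Eg; apply: supnorm_le; first by rewrite addr_ge0// supnorm_ge0.
by move=> x Kx; rewrite (le_trans (ler_normD _ _))// lerD// le_supnorm.
Qed.

Lemma supnormZ K f (a : R) : compact K -> E f ->
  supnorm K (a *: f) <= `|a| * supnorm K f.
Proof.
move=> cK Ef; apply: supnorm_le; first by rewrite mulr_ge0// supnorm_ge0.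
by move=> x Kx; rewrite normrM ler_wpM2l// le_supnorm.
Qed.

Definition cball K f (e : R) : set (V -> R) := [set g | E g /\ supnorm K (g - f) < e].

Lemma cball_center K f (e : R) : E f -> 0 < e -> cball K f e f.
Proof.
move=> Ef e0; split=> //; rewrite subrr (le_lt_trans _ e0)// supnorm_le// => x _.
by rewrite normr0.
Qed.

Lemma co_open_cball K f (e : R) : compact K -> E f -> co_open E (cball K f e).
Proof.
move=> cK Ef; split; first by move=> g [].
move=> g [Eg ge]; exists K, (e - supnorm K (g - f)).
split; rewrite ?subr_gt0// => g' Eg'; rewrite ltrBrDr => H; split=> //.
apply: le_lt_trans H; rewrite -(subrK g g') -addrA addrK supnormD//; exact: CkappaB.
Qed.

(** The sets [cball K f e] are open and convex and form a base of neighbourhoods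
    of [f], which gives the axioms; the constants in the scaling axiom come from
    [b f' - a f = b (f' - f) + (b - a) f]. *)
Lemma co_open_lc : lc_topology E (co_open E).
Proof.
split.
- by move=> U [].
- by split=> // f Ef; exists set0, 1; split=> //; exact: compact0.
- move=> U W [UE HU] [WE HW]; split; first by move=> f [/UE].
  move=> f [Uf Wf]; have Ef := UE _ Uf.
  have [K1 [e1 [cK1 e10 H1]]] := HU _ Uf.
  have [K2 [e2 [cK2 e20 H2]]] := HW _ Wf.
  exists (K1 `|` K2), (Num.min e1 e2); split; first exact: compactU.
    by rewrite lt_min e10.
  move=> g Eg; rewrite lt_min => /andP[g1 g2].
  have cK : compact (K1 `|` K2) by exact: compactU.
  have EB := CkappaB Eg Ef.
  split; [apply: H1|apply: H2] => //.
  + apply: le_lt_trans g1; apply: supnorm_le; first exact: supnorm_ge0.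
    by move=> x Kx; apply: le_supnorm => //; left.
  + apply: le_lt_trans g2; apply: supnorm_le; first exact: supnorm_ge0.
    by move=> x Kx; apply: le_supnorm => //; right.
- move=> C HC; split; first by move=> f [U /HC[UE _]]; exact: UE.
  move=> f [U CU Uf]; have [_ /(_ f Uf)[K [e [cK e0 H]]]] := HC _ CU.
  by exists K, e; split=> // g Eg /(H g Eg) Ug; exists U.
- move=> f g U Ef Eg [UE HU] Ufg; have [K [e [cK e0 H]]] := HU _ Ufg.
  exists (cball K f (e / 2)), (cball K g (e / 2)).
  split; [exact: co_open_cball|exact: co_open_cball|
    apply: cball_center => //; exact: divr_gt0|
    apply: cball_center => //; exact: divr_gt0|].
  move=> f' g' [Ef' Hf] [Eg' Hg]; apply: H; first exact: CkappaD.
  rewrite opprD addrACA; apply: le_lt_trans (_ : supnorm K (f' - f) + supnorm K (g' - g) < e).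
    by apply: supnormD => //; exact: CkappaB.
  by rewrite (splitr e) ltrD.
- move=> a f U Ef [UE HU] Uaf; have [K [e [cK e0 H]]] := HU _ Uaf.
  set N := supnorm K f; have N0 : 0 <= N := supnorm_ge0 _ _.
  have p1 : 0 < N + 1 by rewrite ltr_wpDl.
  have p2 : 0 < `|a| + 1 by rewrite ltr_wpDl.
  exists (Num.min 1 (e / 2 / (N + 1))), (cball K f (e / 2 / (`|a| + 1))).
  split.
  + by rewrite lt_min ltr01 !divr_gt0.
  + exact: co_open_cball.
  + by apply: cball_center => //; rewrite !divr_gt0.
  move=> b f'; rewrite lt_min => /andP[b1 b2] [Ef' Hf].
  have EB := CkappaB Ef' Ef.
  apply: H; first exact: CkappaZ.
  have -> : b *: f' - a *: f = b *: (f' - f) + (b - a) *: f.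
    by rewrite scalerBr scalerBl addrA subrK.
  apply: le_lt_trans (_ : `|b| * supnorm K (f' - f) + `|b - a| * N < e).
    rewrite (le_trans (supnormD _ _ _))//; [exact: CkappaZ|exact: CkappaZ|].
    by rewrite lerD// supnormZ.
  have bA : `|b| <= `|a| + 1.
    by rewrite -(subrK a b) addrC (le_trans (ler_normD _ _))// lerD2l ltW.
  rewrite [ltRHS](splitr e); apply: ltr_leD.
    rewrite (le_lt_trans (ler_wpM2r _ bA)) ?supnorm_ge0//.
    by rewrite mulrC -ltr_pdivlMr.
  rewrite (le_trans (ler_wpM2r N0 (ltW b2)))// mulrAC ler_pdivrMr//.
  by rewrite ler_wpM2l ?divr_ge0 ?(ltW e0)// lerDl.
move=> f U [UE HU] Uf; have [K [e [cK e0 H]]] := HU _ Uf.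
have Ef := UE _ Uf.
exists (cball K f e); split; [exact: co_open_cball|exact: cball_center| |].
  by move=> g [Eg]; exact: H.
move=> g h l [Eg Hg] [Eh Hh] /andP[l0 l1].
have l1' : 0 <= 1 - l by rewrite subr_ge0.
split; first by apply: CkappaD; exact: CkappaZ.
have -> : l *: g + (1 - l) *: h - f = l *: (g - f) + (1 - l) *: (h - f).
  by apply/funext => x; rewrite !fctE /GRing.scale/=; ring.
have Bg := CkappaB Eg Ef; have Bh := CkappaB Eh Ef.
have : supnorm K (l *: (g - f) + (1 - l) *: (h - f)) <=
    l * supnorm K (g - f) + (1 - l) * supnorm K (h - f).
  rewrite (le_trans (supnormD _ _ _))//; [exact: CkappaZ|exact: CkappaZ|].
  by rewrite lerD// (le_trans (supnormZ _ _ _))// ger0_norm.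
move/le_lt_trans; apply.
have [->|ln0] := eqVneq l 0; first by rewrite mul0r add0r subr0 mul1r.
have : l * supnorm K (g - f) < l * e by rewrite ltr_pM2l// lt_neqAle eq_sym ln0.
have : (1 - l) * supnorm K (h - f) <= (1 - l) * e by rewrite ler_wpM2l// ltW.
by move: (supnorm K (g - f)) (supnorm K (h - f)) => p q; lra.
Qed.

(** The topology of uniform convergence on compact sets trivially coincides
    with itself on bounded sets, so its open sets are open for the mixed
    topology. *)
Lemma mixed_cvg_supnorm {T : Type} (F : set_system T) (u : T -> V -> R) f K (e : R) :
  mixed_cvg kappa F u f -> E f -> compact K -> 0 < e ->
  \forall i \near F, E (u i) /\ supnorm K (u i - f) < e.
Proof.
move=> uf Ef cK e0; apply: (uf (cball K f e)); last exact: cball_center.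
by exists (co_open E); split; [exact: co_open_lc| |exact: co_open_cball].
Qed.

(** The family and its limit eventually lie in one bounded set [B], on which any
    competing topology has the same trace as uniform convergence on compact
    sets. *)
Lemma mixed_cvg_bounded_loc {T : Type} (F : set_system T) (u : T -> V -> R) f (r : R) :
  Filter F -> E f -> (\forall i \near F, E (u i) /\ wle kappa setT (u i) r) ->
  (forall rho eps, 0 < eps -> \forall i \near F, forall x, `|x| <= rho ->
     `|u i x - f x| <= eps) ->
  mixed_cvg kappa F u f.
Proof.
move=> FF Ef Hr uf U [tau [_ coinB tU]] Uf.
pose s := Num.max 0 (Num.max r (knorm kappa setT f)).
pose B := Cball kappa setT s.
have coin : coincide_on B tau (co_open E) by apply: coinB; exists s.
have : [set U `&` B | U in tau] (U `&` B) by exists U.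
rewrite [X in X _]coin => -[W [WE HW] WU].
have Bf : B f by split=> //; rewrite /s !le_max lexx !orbT.
have : (W `&` B) f by rewrite WU.
move=> [/HW[K [e [cK e0 H]]] _]; have [rho _ Krho] := compact_sub_nball cK.
have e20 : 0 < e / 2 by rewrite divr_gt0.
near=> i.
suff : (W `&` B) (u i) by rewrite WU => -[].
have [Eu ur] : E (u i) /\ wle kappa setT (u i) r by near: i.
split.
  apply: H => //; apply: (@le_lt_trans _ _ (e / 2)); last first.
    by rewrite ltr_pdivrMr// ltr_pMr// ltr1n.
  apply: supnorm_le; first exact: ltW.
  move=> x /Krho; have : forall x, `|x| <= rho -> `|u i x - f x| <= e / 2.
    by near: i; exact: uf.
  exact.
split=> //; apply: knorm_le; first by rewrite le_max lexx.
by move=> x _; rewrite (le_trans (ur x I))// !le_max lexx orbT.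
Unshelve. all: by end_near. Qed.

Lemma mixed_cvg_unique {T : Type} (F : set_system T) (u : T -> V -> R) f g :
  ProperFilter F -> E f -> E g ->
  mixed_cvg kappa F u f -> mixed_cvg kappa F u g -> f = g.
Proof.
move=> FF Ef Eg uf ug; apply/funext => x.
apply/eqP; rewrite -subr_eq0 -normr_le0; apply/ler_addgt0Pr => e e0.
have e20 : 0 < e / 2 by rewrite divr_gt0.
have c1 : compact [set x] by exact: compact_set1.
have H1 := mixed_cvg_supnorm uf Ef c1 e20.
have H2 := mixed_cvg_supnorm ug Eg c1 e20.
have [i [[Eu /ltW h1] [_ /ltW h2]]] := filter_ex (filterI H1 H2).
have /= k1 := le_supnorm c1 (CkappaB Eu Ef) erefl.
have /= k2 := le_supnorm c1 (CkappaB Eu Eg) erefl.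
have {k1 h1}k1 := le_trans k1 h1; have {k2 h2}k2 := le_trans k2 h2.
have -> : f x - g x = (u i x - g x) - (u i x - f x) by ring.
by rewrite add0r (splitr e) (le_trans (ler_normB _ _))// lerD.
Qed.

End Mixed.

(** * Discretization schemes *)

Section LocalConvergence.
Context {R : realType} {d : nat} (kappa : 'rV[R]_d -> R) (wk : weight kappa).
Local Notation V := 'rV[R]_d.
Variable X : nat -> set V.
Hypothesis X_dense : forall x : V, exists xn : nat -> V,
  (forall n, X n (xn n)) /\ xn n @[n --> \oo] --> x.

(** The local part of [cvg_along].  No condition that the ball meets every [X n]
    is imposed: large balls do, and small ones are contained in large ones. *)
Definition loc_cvg (u : nat -> V -> R) f := forall rho eps : R, 0 < eps ->
  \forall n \near \oo, forall x, X n x -> `|x| <= rho -> `|u n x - f x| <= eps.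

Lemma cvg_along_loc (u : nat -> V -> R) f :
  Ckappa kappa setT f -> (forall n, Ckappa kappa (X n) (u n)) ->
  cvg_along kappa X u f ->
  (exists2 M, 0 <= M & forall n, wle kappa (X n) (u n) M) /\ loc_cvg u f.
Proof.
move=> Ef Eu [[M HM] H].
have uM n : wle kappa (X n) (u n) (Num.max 0 M).
  by move=> x /(wle_knorm (Eu n))/le_trans; apply; rewrite le_max HM orbT.
split; first by exists (Num.max 0 M) => //; rewrite le_max lexx.
(* Enlarge the ball until it meets every [X n]: it must contain a bounded
   sequence of points of the sets [X n], here one converging to 0. *)
move=> rho eps e0; have [xn [Xxn xn0]] := X_dense 0.
have /cvg_seq_bounded[N [_ HN]] : cvgn xn by apply/cvg_ex; exists 0.
pose s := Num.max rho (N + 1).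
have sK n : nball s `&` X n !=set0.
  exists (xn n); split => //; rewrite /nball/= (le_trans (HN (N + 1) _ n I))//.
    by rewrite ltrDl.
  by rewrite /s le_max lexx orbT.
have := H _ (@compact_nball R d s) sK => /cvgr0Pnorm_le/(_ _ e0).
have [C C0 HC] := wle_nball wk s.
have [_ [M' HM']] := Ef.
apply: filterS => n /= Hn x Xx xr; rewrite distrC.
apply: (le_trans _ (le_trans (ler_norm _) Hn)).
apply: (@supnorm_ge _ _ (nball s `&` X n) (f - u n) (C * M' + C * Num.max 0 M)).
  move=> y [ys Xy]; rewrite (le_trans (ler_normB _ _))// lerD//.
    exact: (HC setT).
  exact: (HC (X n)).
by split => //; rewrite /nball/= (le_trans xr)// /s le_max lexx.
Qed.

Lemma loc_cvg_along (u : nat -> V -> R) f (M : R) : 0 <= M ->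
  (forall n, wle kappa (X n) (u n) M) -> loc_cvg u f -> cvg_along kappa X u f.
Proof.
move=> M0 uM uf; split; first by exists M => n; exact: knorm_le.
move=> K /compact_sub_nball[rho _ Krho] _; apply/cvgr0Pnorm_le => e e0.
apply: filterS (uf rho e e0) => n Hn; rewrite ger0_norm ?supnorm_ge0//.
apply: supnorm_le; first exact: ltW.
by move=> x [/Krho xr Xx]; rewrite distrC; exact: Hn.
Qed.

End LocalConvergence.

Lemma iter_operator {R : realType} {d : nat} (kappa : 'rV[R]_d -> R)
    (Y : set 'rV[R]_d) J k f :
  operator_on kappa Y J -> Ckappa kappa Y f -> Ckappa kappa Y (iter k J f).
Proof. by move=> HJ Ef; elim: k => //= k; exact: (op_maps HJ). Qed.

(** The hypotheses on [I_n] in pointwise form.  This package is stable under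
    passing to a subsequence ([scheme_subseq]), so the whole limit theory can be
    developed for a sequence that converges outright.  In [sc_D0], [M] bounds
    the difference quotients of the approximants, hence the speed in time of
    their iterates. *)
Record scheme {R : realType} {d : nat} (kappa : 'rV[R]_d -> R) (h : nat -> R)
  (X : nat -> set 'rV[R]_d) (I_ : nat -> ('rV[R]_d -> R) -> 'rV[R]_d -> R)
  (omega : R) (D0 : set ('rV[R]_d -> R)) : Prop := Scheme {
  sc_weight : weight kappa;
  sc_gt0 : forall n, 0 < h n;
  sc_to0 : h n @[n --> \oo] --> 0;
  sc_dense : forall x : 'rV[R]_d, exists xn : nat -> 'rV[R]_d,
    (forall n, X n (xn n)) /\ xn n @[n --> \oo] --> x;
  sc_op : forall n, operator_on kappa (X n) (I_ n);
  sc_convex : forall n, convex_op kappa (X n) (I_ n);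
  sc_mono : forall n, monotone_op kappa (X n) (I_ n);
  sc_zero : forall n x, X n x -> I_ n 0 x = 0;
  sc_omega : 0 <= omega;
  sc_lip : forall n f g b, Ckappa kappa (X n) f -> Ckappa kappa (X n) g ->
    0 <= b -> wle kappa (X n) (f - g) b ->
    wle kappa (X n) (I_ n f - I_ n g) (expR (omega * h n) * b);
  sc_local : forall eps r T rho : R, 0 < eps -> 0 <= r -> 0 <= T ->
    exists c rho' : R, 0 <= c /\ forall k n f g b, k%:R * h n <= T ->
      Ckappa kappa (X n) f -> wle kappa (X n) f r ->
      Ckappa kappa (X n) g -> wle kappa (X n) g r -> 0 <= b ->
      (forall y, X n y -> `|y| <= rho' -> `|f y - g y| <= b) ->
      forall x, X n x -> `|x| <= rho ->
        `|iter k (I_ n) f x - iter k (I_ n) g x| <= c * b + eps;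
  sc_Lip : forall n r f, 0 <= r -> Lip_br (X n) r f ->
    Lip_br (X n) (expR (omega * h n) * r) (I_ n f);
  sc_D0 : forall f, D0 f -> Ckappa kappa setT f /\
    exists r (fbar : nat -> 'rV[R]_d -> R) M,
      [/\ 0 <= r, 0 <= M, forall n, Lip_br (X n) r (fbar n), loc_cvg X fbar f &
        forall n, wle kappa (X n) (fbar n) (knorm kappa setT f) /\
          wle kappa (X n) (I_ n (fbar n) - fbar n) (h n * M)];
  sc_D0_dense : forall f rho eps, Ckappa kappa setT f -> 0 < eps ->
    exists g, [/\ D0 g, knorm kappa setT g <= knorm kappa setT f &
      forall x, `|x| <= rho -> `|f x - g x| <= eps] }.

Lemma ler_expRM {R : realType} (omega s t : R) : 0 <= omega -> s <= t ->
  expR (omega * s) <= expR (omega * t).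
Proof. by move=> omega0 st; rewrite ler_expR ler_wpM2l. Qed.

Section Iterates.
Context {R : realType} {d : nat} (kappa : 'rV[R]_d -> R) (h : nat -> R)
  (X : nat -> set 'rV[R]_d) (I_ : nat -> ('rV[R]_d -> R) -> 'rV[R]_d -> R)
  (omega : R) (D0 : set ('rV[R]_d -> R)) (sc : scheme kappa h X I_ omega D0).
Local Notation V := 'rV[R]_d.
Implicit Types (f g : V -> R).

Lemma iter_Ckappa k n f : Ckappa kappa (X n) f ->
  Ckappa kappa (X n) (iter k (I_ n) f).
Proof. exact/iter_operator/(sc_op sc). Qed.

Let k0 x : 0 < kappa x. Proof. exact: weight_gt0 (sc_weight sc) x. Qed.

Lemma iter_lip k n f g b : Ckappa kappa (X n) f -> Ckappa kappa (X n) g ->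
  0 <= b -> wle kappa (X n) (f - g) b ->
  wle kappa (X n) (iter k (I_ n) f - iter k (I_ n) g)
    (expR (omega * (k%:R * h n)) * b).
Proof.
move=> Ef Eg b0 H; elim: k => [|k IH] /=; first by rewrite mul0r mulr0 expR0 mul1r.
have -> : omega * (k.+1%:R * h n) = omega * h n + omega * (k%:R * h n).
  by rewrite -natr1; ring.
rewrite expRD -mulrA; apply: (sc_lip sc) => //; try exact: iter_Ckappa.
by rewrite mulr_ge0// expR_ge0.
Qed.

Lemma iter_zero k n x : X n x -> iter k (I_ n) 0 x = 0.
Proof.
move=> Xx; elim: k x Xx => [//|k IH] x Xx /=; rewrite -[RHS](sc_zero sc Xx).
apply: (op_ext (sc_op sc n)) => //; first by apply: iter_Ckappa; exact: Ckappa0.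
exact: Ckappa0.
Qed.

Lemma iter_norm k n f b : Ckappa kappa (X n) f -> 0 <= b -> wle kappa (X n) f b ->
  wle kappa (X n) (iter k (I_ n) f) (expR (omega * (k%:R * h n)) * b).
Proof.
move=> Ef b0 H x Xx.
have := @iter_lip k n f 0 b Ef (Ckappa0 _ _) b0; rewrite subr0 => /(_ H x Xx).
suff -> : (iter k (I_ n) f - iter k (I_ n) 0) x = iter k (I_ n) f x by [].
by rewrite -[RHS]subr0 -(iter_zero k Xx).
Qed.

Lemma iter_mono k n : monotone_op kappa (X n) (iter k (I_ n)).
Proof.
move=> f g Ef Eg fg; elim: k => //= k IH x Xx.
by apply: (sc_mono sc) => //; exact: iter_Ckappa.
Qed.

Lemma iter_convex k n : convex_op kappa (X n) (iter k (I_ n)).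
Proof.
move=> f g l Ef Eg l01; elim: k => //= k IH x Xx.
have EZ a u := @CkappaZ _ _ kappa (X n) u a.
have ED u v := @CkappaD _ _ kappa (sc_weight sc) (X n) u v.
have Ei u := @iter_Ckappa k n u.
apply: (@le_trans _ _ (I_ n (l *: iter k (I_ n) f + (1 - l) *: iter k (I_ n) g) x)).
  by apply: (sc_mono sc) => //; auto.
by apply: (sc_convex sc) => //; auto.
Qed.

Lemma iter_Lip k n r f : 0 <= r -> Lip_br (X n) r f ->
  Lip_br (X n) (expR (omega * (k%:R * h n)) * r) (iter k (I_ n) f).
Proof.
move=> r0 H; elim: k => [|k IH] /=; first by rewrite mul0r mulr0 expR0 mul1r.
have -> : omega * (k.+1%:R * h n) = omega * h n + omega * (k%:R * h n).
  by rewrite -natr1; ring.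
by rewrite expRD -mulrA; apply: (sc_Lip sc) => //; rewrite mulr_ge0// expR_ge0.
Qed.

(** Telescoping: the [k] increments [I^(i+1) f - I^i f] are bounded by
    the first one, up to the Lipschitz constant of [I^i]. *)
Lemma iter_time k n f M : Ckappa kappa (X n) f -> 0 <= M ->
  wle kappa (X n) (I_ n f - f) (h n * M) ->
  wle kappa (X n) (iter k (I_ n) f - f)
    (k%:R * h n * (expR (omega * (k%:R * h n)) * M)).
Proof.
move=> Ef M0 H; have h0 := sc_gt0 sc n; elim: k => [|k IH].
  by rewrite /= subrr !mul0r => x _; rewrite normr0 mul0r.
have -> : iter k.+1 (I_ n) f - f =
    (iter k (I_ n) (I_ n f) - iter k (I_ n) f) + (iter k (I_ n) f - f).
  by rewrite addrA subrK iterSr.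
have H1 := @iter_lip k n (I_ n f) f (h n * M) (op_maps (sc_op sc n) Ef) Ef
  (mulr_ge0 (ltW h0) M0) H.
apply: wle_le (wleD (sc_weight sc) H1 IH).
rewrite -natr1 [X in _ <= X * _ * _]addrC [X in _ <= X * _]mulrDl mul1r.
rewrite [leRHS]mulrDl lerD//.
  rewrite mulrCA ler_wpM2l ?(ltW h0)// ler_wpM2r//.
  by apply: (ler_expRM (sc_omega sc)); rewrite ler_wpM2r ?lerDl// ltW.
rewrite ler_wpM2l ?mulr_ge0 ?(ltW h0)// ler_wpM2r//.
by apply: (ler_expRM (sc_omega sc)); rewrite ler_wpM2r ?lerDl// ltW.
Qed.

Lemma iter_time_le j k n f M : (j <= k)%N -> Ckappa kappa (X n) f -> 0 <= M ->
  wle kappa (X n) (I_ n f - f) (h n * M) ->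
  wle kappa (X n) (iter k (I_ n) f - iter j (I_ n) f)
    ((k%:R * h n - j%:R * h n) * (expR (omega * (k%:R * h n)) * M)).
Proof.
move=> jk Ef M0 H; have h0 := sc_gt0 sc n.
have := @iter_time (k - j) n f M Ef M0 H => H1.
have H2 := @iter_lip j n _ _ _ (@iter_Ckappa (k - j) n f Ef) Ef
  (_ : 0 <= (k - j)%:R * h n * (expR (omega * ((k - j)%:R * h n)) * M)) H1.
rewrite -{1}(subnKC jk) iterD; apply: wle_le; last first.
  by apply: H2; rewrite !mulr_ge0// ?expR_ge0// ltW.
rewrite natrB// mulrCA -[in leRHS]mulrBl ler_wpM2l//.
  by rewrite mulr_ge0 ?subr_ge0 ?ler_nat// ltW.
by rewrite [leLHS]mulrA -expRD -mulrDr -mulrDl addrC subrK.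
Qed.

End Iterates.

(** * Asymptotic equicontinuity *)

Section Equicontinuity.
Context {R : realType} {d : nat} (kappa : 'rV[R]_d -> R) (h : nat -> R)
  (X : nat -> set 'rV[R]_d) (I_ : nat -> ('rV[R]_d -> R) -> 'rV[R]_d -> R)
  (omega : R) (D0 : set ('rV[R]_d -> R)) (sc : scheme kappa h X I_ omega D0).
Local Notation V := 'rV[R]_d.
Local Notation E := (Ckappa kappa setT).
Implicit Types (f g : V -> R) (u v : nat -> V -> R).

Let k0 x : 0 < kappa x. Proof. exact: weight_gt0 (sc_weight sc) x. Qed.

(** Convergence [u -> f] with a common bound [r] for the weighted norms of the
    [u n] and of [f].  The bound is explicit because the constants in
    the local equicontinuity depend on it. *)
Record bcvg (r : R) u f : Prop := Bcvg {
  bcvg_ge0 : 0 <= r;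
  bcvg_lim : E f;
  bcvg_lim_le : wle kappa setT f r;
  bcvg_seq : forall n, Ckappa kappa (X n) (u n);
  bcvg_seq_le : forall n, wle kappa (X n) (u n) r;
  bcvg_cvg : loc_cvg X u f }.

Lemma bcvg_weaken r s u f : r <= s -> bcvg r u f -> bcvg s u f.
Proof.
move=> rs [r0 Ef fr Eu ur uf]; split => //; first exact: le_trans rs.
- by move=> x _; rewrite (le_trans (fr x I)).
- by move=> n x Xx; rewrite (le_trans (ur n x Xx)).
Qed.

Lemma bcvg_cst f r : E f -> 0 <= r -> wle kappa setT f r -> bcvg r (fun=> f) f.
Proof.
move=> Ef r0 fr; split => //.
- by move=> n; exact: Ckappa_restrict.
- by move=> n x _; exact: fr.
- by move=> rho eps e0; near=> n => x _ _; rewrite subrr normr0 ltW.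
Unshelve. all: by end_near. Qed.

Lemma bcvg_knorm f : E f -> bcvg (knorm kappa setT f) (fun=> f) f.
Proof.
by move=> Ef; apply: bcvg_cst => //; [exact: knorm_ge0|exact: wle_knorm].
Qed.

Lemma bcvg_cvg_along u f : E f -> (forall n, Ckappa kappa (X n) (u n)) ->
  cvg_along kappa X u f -> exists r, bcvg r u f.
Proof.
move=> Ef Eu uf; have [[M M0 uM] lc] := cvg_along_loc (sc_weight sc) (sc_dense sc) Ef Eu uf.
exists (Num.max M (knorm kappa setT f)); split => //.
- by rewrite le_max M0.
- by move=> x /(wle_knorm Ef)/le_trans; apply; rewrite le_max lexx orbT.
- by move=> n x /(uM n)/le_trans; apply; rewrite le_max lexx.
Qed.

(** Every [f] can be traded for an element [g] of [D0], uniformly in the number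
    of steps and for all sequences converging to [f] and to [g].  The choice of
    [g] comes after that of the constants [c] and [rho'] of the local
    equicontinuity, which depend only on [r], [T], [rho] and [eps]. *)
Lemma approx_D0 r f T rho eps : E f -> 0 <= r -> wle kappa setT f r ->
  0 <= T -> 0 < eps -> exists g, [/\ D0 g, wle kappa setT g r,
    knorm kappa setT g <= r &
    forall u v, bcvg r u f -> bcvg r v g -> \forall n \near \oo,
    forall k x, k%:R * h n <= T -> X n x -> `|x| <= rho ->
    `|iter k (I_ n) (u n) x - iter k (I_ n) (v n) x| <= eps].
Proof.
move=> Ef r0 fr T0 e0; have e20 : 0 < eps / 2 by rewrite divr_gt0.
have [c [rho' [c0 Hc]]] := sc_local sc rho e20 r0 T0.
have c1 : 0 < c + 1 by rewrite ltr_wpDl.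
(* [3 * eta] bounds the distance from [u n] to [v n] through [f] and [g]. *)
pose eta := eps / 2 / (3 * (c + 1)).
have eta0 : 0 < eta by rewrite !divr_gt0// mulr_gt0.
have [g [Dg gf fg]] := sc_D0_dense sc rho' Ef eta0.
have Eg : E g by have [] := sc_D0 sc Dg.
have gr : knorm kappa setT g <= r by rewrite (le_trans gf)// knorm_le.
exists g; split => //.
  by move=> x _; rewrite (le_trans _ gr)//; exact: wle_knorm.
move=> u v [_ _ _ Eu ur uf] [_ _ _ Ev vr vg]; near=> n => k x kT Xx xr.
have un : forall x, X n x -> `|x| <= rho' -> `|u n x - f x| <= eta.
  by near: n; exact: uf.
have vn : forall x, X n x -> `|x| <= rho' -> `|v n x - g x| <= eta.
  by near: n; exact: vg.
apply: (le_trans (Hc k n (u n) (v n) (3 * eta) kT _ _ _ _ _ _ x Xx xr)) => //.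
- by rewrite mulr_ge0// ltW.
- move=> y Xy yr; have -> : u n y - v n y = (u n y - f y) + (f y - g y) - (v n y - g y).
    by ring.
  have -> : 3 * eta = eta + eta + eta by ring.
  rewrite (le_trans (ler_normB _ _))// lerD ?vn// (le_trans (ler_normD _ _))//.
  by rewrite lerD ?un ?fg.
- rewrite [leRHS](splitr eps) lerD// /eta.
  have -> : c * (3 * (eps / 2 / (3 * (c + 1)))) = (c * (eps / 2)) / (c + 1).
    by field; apply/lt0r_neq0.
  by rewrite ler_pdivrMr// mulrC ler_wpM2l ?(ltW e20)// lerDl.
Unshelve. all: by end_near. Qed.

(** After replacing [u] and [v] by the approximants [fb] of an element of [D0],
    the difference splits into a spatial part, controlled by the Lipschitz
    bound on [I^k fb], and a temporal part, controlled by [iter_time_le]. *)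
Lemma equicontinuity r u v f T rho eps : bcvg r u f -> bcvg r v f ->
  0 <= T -> 0 < eps -> exists2 del, 0 < del & \forall n \near \oo,
    forall k j x y, k%:R * h n <= T -> j%:R * h n <= T ->
      `|k%:R * h n - j%:R * h n| <= del -> X n x -> X n y ->
      `|x| <= rho -> `|y| <= rho -> `|x - y| <= del ->
      `|iter k (I_ n) (u n) x - iter j (I_ n) (v n) y| <= eps.
Proof.
move=> au av T0 e0; have e40 : 0 < eps / 4 by rewrite divr_gt0.
have [r0 Ef fr _ _ _] := au.
have [g [Dg gr gkr Hg]] := approx_D0 rho Ef r0 fr T0 e40.
have [Eg [L [fb [M [L0 M0 fbL fbg fbM]]]]] := sc_D0 sc Dg.
have afb : bcvg r fb g.
  split => //.
  - by move=> n; apply: Lip_br_Ckappa (fbL n) => //; exact: sc_weight sc.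
  - by move=> n x Xx; have [/(_ x Xx)/le_trans + _] := fbM n; apply.
pose eT := expR (omega * T).
have eT0 : 0 < eT by rewrite expR_gt0.
have [C C0 HC] := wle_nball (sc_weight sc) rho.
have p1 : 0 < eT * L + 1 by rewrite ltr_wpDl// mulr_ge0// ltW.
have p2 : 0 < C * (eT * M) + 1 by rewrite ltr_wpDl// !mulr_ge0// ltW.
have [del1 del10 Hd1] := @enorm_small R d _ (divr_gt0 e40 p1).
pose del2 := eps / 4 / (C * (eT * M) + 1).
have del20 : 0 < del2 by exact: divr_gt0.
exists (Num.min del1 del2); first by rewrite lt_min del10.
near=> n => k j x y kT jT; rewrite !le_min => /andP[_ kj] Xx Xy xr yr /andP[xy _].
have Hu : forall k x, k%:R * h n <= T -> X n x -> `|x| <= rho ->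
    `|iter k (I_ n) (u n) x - iter k (I_ n) (fb n) x| <= eps / 4.
  by near: n; exact: Hg.
have Hv : forall k x, k%:R * h n <= T -> X n x -> `|x| <= rho ->
    `|iter k (I_ n) (v n) x - iter k (I_ n) (fb n) x| <= eps / 4.
  by near: n; exact: Hg.
have Hx : `|iter k (I_ n) (fb n) x - iter k (I_ n) (fb n) y| <= eps / 4.
  have [/(_ x y Xx Xy) + _] := iter_Lip sc k L0 (fbL n).
  move/le_trans; apply; apply: (@le_trans _ _ (eT * L * (eps / 4 / (eT * L + 1)))).
    apply: ler_pM; rewrite ?mulr_ge0 ?expR_ge0 ?sqrtr_ge0 ?Hd1//.
    by rewrite ler_wpM2r// (ler_expRM (sc_omega sc)).
  rewrite mulrA ler_pdivrMr// mulrC ler_wpM2l ?(ltW e40)//.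
  by rewrite lerDl.
have Ht : `|iter k (I_ n) (fb n) y - iter j (I_ n) (fb n) y| <= eps / 4.
  wlog jk : k j kT jT kj {Hx} / (j <= k)%N.
    move=> W; have [jk|kj'] := leqP j k; first exact: W.
    by rewrite distrC; apply: W => //; [rewrite distrC|exact: ltnW].
  have h0 := sc_gt0 sc n.
  have H1 := iter_time_le sc jk (bcvg_seq afb n) M0 (fbM n).2.
  apply: (le_trans (HC _ _ _ H1 y Xy yr)).
  have kj0 : 0 <= k%:R * h n - j%:R * h n.
    by rewrite subr_ge0 ler_wpM2r ?(ltW h0)// ler_nat.
  rewrite (ger0_norm kj0) in kj.
  apply: (@le_trans _ _ (C * (del2 * (eT * M)))).
    rewrite ler_wpM2l ?(ltW C0)//; apply: ler_pM => //.
      by rewrite mulr_ge0 ?expR_ge0.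
    by rewrite ler_wpM2r// (ler_expRM (sc_omega sc)).
  rewrite mulrCA /del2 mulrAC ler_pdivrMr// ler_wpM2l ?(ltW e40)//.
  by rewrite lerDl.
have -> : iter k (I_ n) (u n) x - iter j (I_ n) (v n) y =
  (iter k (I_ n) (u n) x - iter k (I_ n) (fb n) x) +
  (iter k (I_ n) (fb n) x - iter k (I_ n) (fb n) y) +
  (iter k (I_ n) (fb n) y - iter j (I_ n) (fb n) y) -
  (iter j (I_ n) (v n) y - iter j (I_ n) (fb n) y) by ring.
have -> : eps = eps / 4 + eps / 4 + eps / 4 + eps / 4 by field.
rewrite (le_trans (ler_normB _ _))// lerD ?Hv//.
rewrite (le_trans (ler_normD _ _))// lerD//.
by rewrite (le_trans (ler_normD _ _))// lerD// Hu.
Unshelve. all: by end_near. Qed.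

End Equicontinuity.

(** * Extraction of a subsequence *)

(** Instead of nested subsequences: choose an ultrafilter finer than the filter
    at infinity, let [a i] be the limit of [w i] along it, and pick indices at
    which the first [l] sequences are [1/(l+1)]-close to their limits.  Such
    indices are arbitrarily large because ultrafilter sets intersect. *)
Lemma diagonal_subsequence {R : realType} (w : nat -> nat -> R) :
  (forall i, exists M, forall n, `|w i n| <= M) ->
  exists nl : nat -> nat, {homo nl : i j / (i < j)%N} /\
    forall i, cvgn (fun l => w i (nl l)).
Proof.
move=> wM; have [U [UU oU]] := @ultraFilterLemma nat \oo _.
have /choice[a Ha] : forall i, exists a : R, (w i n @[n --> U]) --> a.
  move=> i; have [M HM] := wM i.
  have [|a [_ Ha]] := @segment_compact R (- M) M (w i n @[n --> U]) _.
    by apply: oU; near=> n => /=; rewrite in_itv /= -ler_norml.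
  exists a => B aB; have [//|nB] := in_ultra_setVsetC (w i @^-1` B) UU.
  by have [y []] := Ha (~` B) B nB aB.
have step (l m : nat) : exists n, (m < n)%N /\
    forall i, (i <= l)%N -> `|a i - w i n| < l.+1%:R^-1.
  have H : \forall n \near U, forall i : 'I_l.+1, `|a i - w i n| < l.+1%:R^-1.
    apply: filter_forall => i; have /cvgrPdist_lt := Ha i; apply.
    by rewrite invr_gt0.
  have H2 : \forall n \near U, (m < n)%N by apply: oU; exact: nbhs_infty_gt.
  have [n [n1 n2]] := filter_ex (filterI H H2).
  by exists n; split=> // i il; exact: (n1 (Ordinal (il : (i < l.+1)%N))).
have /choice[F HF] : forall lm : nat * nat, exists n, (lm.2 < n)%N /\
    forall i, (i <= lm.1)%N -> `|a i - w i n| < lm.1.+1%:R^-1.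
  by move=> [l m]; exact: step.
pose nl := fix nl l := if l is l'.+1 then F (l, nl l') else F (0, 0)%N.
have nlP l i : (i <= l)%N -> `|a i - w i (nl l)| < l.+1%:R^-1.
  by case: l => [|l]; [exact: (HF (0, 0)%N).2|exact: (HF (l.+1, nl l)).2].
exists nl; split; first by apply: homo_ltn ltn_trans _ => l; exact: (HF (l.+1, nl l)).1.
move=> i; apply/cvg_ex; exists (a i); apply/cvgrPdist_lt => e e0.
near=> l; apply: (lt_trans (nlP l i _)).
  by near: l; exact: nbhs_infty_ge.
by near: l; exact: near_infty_natSinv_lt (PosNum e0).
Unshelve. all: by end_near. Qed.

(** * Density, completeness and the theorem of Dini *)

Section Auxiliary.
Context {R : realType} {d : nat}.
Local Notation V := 'rV[R]_d.

Lemma rat_dense_time (t del : R) : 0 <= t -> 0 < del ->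
  exists2 q : rat, 0 <= ratr q :> R & `|t - ratr q| <= del.
Proof.
move=> t0 d0; have [|q] := @rat_in_itvoo R t (t + del); first by rewrite ltrDl.
rewrite in_itv /= => /andP[tq qd]; exists q; first by rewrite (le_trans t0)// ltW.
by rewrite distrC ger0_norm ?subr_ge0 ?(ltW tq)// lerBlDl ltW.
Qed.

Lemma rat_dense_row (x : V) (del : R) : 0 < del ->
  exists z : 'rV[rat]_d, `|x - map_mx ratr z| <= del.
Proof.
move=> d0; have /choice[z Hz] : forall i, exists q : rat, `|x ord0 i - ratr q| <= del.
  move=> i; have [|q] := @rat_in_itvoo R (x ord0 i) (x ord0 i + del).
    by rewrite ltrDl.
  rewrite in_itv /= => /andP[tq qd]; exists q.
  by rewrite distrC ger0_norm ?subr_ge0 ?(ltW tq)// lerBlDl ltW.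
exists (\row_i z i); rewrite [leLHS]mx_normrE; apply: bigmax_le; first exact: ltW.
by move=> [i j] _ /=; rewrite !mxE ord1 Hz.
Qed.

Lemma cvg_near_approx (u : nat -> R) :
  (forall e, 0 < e -> exists2 v : nat -> R, cvgn v &
     \forall n \near \oo, `|u n - v n| <= e) -> cvgn u.
Proof.
move=> H; apply/cauchy_cvgP; apply: cauchy_exP => e e0.
have e30 : 0 < e / 3 by rewrite divr_gt0.
have [v cv uv] := H _ e30; exists (limn v).
have vl : \forall n \near \oo, `|limn v - v n| <= e / 3.
  by move/cvgrPdist_le : cv; apply.
suff : \forall n \near \oo, ball (limn v) e (u n) by [].
near=> n; rewrite -ball_normE /=.
have -> : limn v - u n = (limn v - v n) - (u n - v n) by ring.
apply: (@le_lt_trans _ _ (e / 3 + e / 3)); last by lra.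
rewrite (le_trans (ler_normB _ _))// lerD//; by near: n.
Unshelve. all: by end_near. Qed.

Lemma Ckappa_continuous (kappa f : V -> R) : Ckappa kappa setT f -> continuous f.
Proof.
move=> [/subspace_continuousP cf _] x B Bx.
have H : nbhs x [set y | setT y -> B (f y)] := cf x I B Bx.
by change (nbhs x (f @^-1` B)); apply: filterS H => y; exact.
Qed.

Lemma decreases_to_homo (fn : nat -> V -> R) f y : decreases_to fn f ->
  {homo fn^~ y : n m / (n <= m)%N >-> m <= n}.
Proof.
move=> [dec _].
by apply: homo_leq => [//|z a b /[swap]|i]; [exact: le_trans|exact: dec].
Qed.

Lemma decreases_to_ge (fn : nat -> V -> R) f n y : decreases_to fn f -> f y <= fn n y.
Proof.
move=> dfn; apply: (cvgr_to_le (dfn.2 y)); near=> m; apply: decreases_to_homo dfn _ _ _.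
by near: m; exact: nbhs_infty_ge.
Unshelve. all: by end_near. Qed.

(** At a point [x] some [fn N] is below [eta], hence near [x] by continuity, and
    monotonicity keeps the later functions below; compactness makes the rank
    uniform. *)
Lemma dini (fn : nat -> V -> R) rho eta : (forall n, continuous (fn n)) ->
  decreases_to fn 0 -> 0 < eta ->
  \forall n \near \oo, forall y, `|y| <= rho -> `|fn n y| <= eta.
Proof.
move=> cfn dfn eta0; have [_ fn0] := dfn.
have mono y := decreases_to_homo y dfn.
have ge0 n y : 0 <= fn n y := decreases_to_ge n y dfn.
have : \forall n \near \oo, nball rho `<=` (fun y => fn n y <= eta).
  apply: (iffLR (compact_near_coveringP _) (@compact_nball R d rho)) => x /= xr.
  have [N HN] : exists N, fn N x < eta.
    have : \forall n \near \oo, fn n x < eta by apply: (cvgr_lt _ (fn0 x)).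
    by move/filter_ex.
  have cN : \forall y \near x, fn N y < eta.
    have c := cfn N x.
    exact: (@cvgr_lt _ _ _ (nbhs_filter x) _ _ c).
  near=> y n; apply: (le_trans (mono y N n _)).
    by near: n; exact: nbhs_infty_ge.
  by apply: ltW; near: y.
by apply: filterS => n Hn y yr; rewrite ger0_norm//; exact: Hn.
Unshelve. all: by end_near. Qed.

End Auxiliary.

(** * The limit semigroup *)

Section Limit.
Context {R : realType} {d : nat} (kappa : 'rV[R]_d -> R) (h : nat -> R)
  (X : nat -> set 'rV[R]_d) (I_ : nat -> ('rV[R]_d -> R) -> 'rV[R]_d -> R)
  (omega : R) (D0 : set ('rV[R]_d -> R)) (sc : scheme kappa h X I_ omega D0).
Local Notation V := 'rV[R]_d.
Local Notation E := (Ckappa kappa setT).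
Local Notation bcvg := (bcvg kappa X).
Implicit Types (f g : V -> R) (u v : nat -> V -> R) (r s t T rho eps : R) (x : V).

Definition steps (t : R) (n : nat) : nat := Num.truncn (t / h n).

Lemma steps_le t n : 0 <= t -> (steps t n)%:R * h n <= t.
Proof.
move=> t0; have h0 := sc_gt0 sc n.
by rewrite -ler_pdivlMr// truncn_le divr_ge0// ltW.
Qed.

Lemma steps_cvg t : 0 <= t -> (steps t n)%:R * h n @[n --> \oo] --> t.
Proof.
move=> t0; apply/cvgrPdist_le => e e0; near=> n; have h0 := sc_gt0 sc n.
rewrite ger0_norm ?subr_ge0 ?steps_le//.
apply: (@le_trans _ _ (h n)).
  rewrite lerBlDl -[X in _ + X]mul1r -mulrDl natr1 -ler_pdivrMr// ltW//.
  by have /andP[] := truncn_itv (divr_ge0 t0 (ltW h0)).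
rewrite -[leLHS]gtr0_norm// -normrN -[- h n]add0r.
by near: n; move/cvgrPdist_le : (sc_to0 sc); apply.
Unshelve. all: by end_near. Qed.

Variable xs : V -> nat -> V.
Hypothesis xsP : forall x, (forall n, X n (xs x n)) /\ xs x n @[n --> \oo] --> x.

(** What the extraction provides: convergence for countably many data. *)
Hypothesis conv : forall g (q : rat) (z : 'rV[rat]_d), D0 g -> 0 <= ratr q :> R ->
  cvgn (fun n => iter (steps (ratr q) n) (I_ n) g (xs (map_mx ratr z) n)).

Lemma near_ball (y : nat -> V) (x : V) rho : y n @[n --> \oo] --> x -> `|x| < rho ->
  \forall n \near \oo, `|y n| <= rho.
Proof. by move=> yx xr; exact: (cvgr_norm_le _ yx). Qed.

Lemma near_dist {W : pseudoMetricNormedZmodType R} (y z : nat -> W) (a b : W) del :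
  y n @[n --> \oo] --> a -> z n @[n --> \oo] --> b -> `|a - b| < del ->
  \forall n \near \oo, `|y n - z n| <= del.
Proof. by move=> ya zb ab; exact: (cvgr_norm_le _ (cvgB ya zb)). Qed.

(** The sequence is asymptotically close, to any precision, to one of the
    countably many sequences that converge by assumption: replace [f] by an
    element of [D0], then [t] and [x] by rational neighbours. *)
Lemma limit_exists f t x : E f -> 0 <= t ->
  cvgn (fun n => iter (steps t n) (I_ n) f (xs x n)).
Proof.
move=> Ef t0; apply: cvg_near_approx => e e0.
have e20 : 0 < e / 2 by rewrite divr_gt0.
have T0 : 0 <= t + 1 by rewrite addr_ge0.
have af := bcvg_knorm sc Ef; have r0 := bcvg_ge0 af.
have [del del0 Hm] := equicontinuity sc (`|x| + 1) af af T0 e20.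
have [g [Dg gr gk Hg]] := approx_D0 sc (`|x| + 1) Ef r0 (bcvg_lim_le af) T0 e20.
have Eg : E g by have [] := sc_D0 sc Dg.
pose s := Num.min (1 / 2) (del / 2).
have s0 : 0 < s by rewrite lt_min !divr_gt0.
have s1 : s < 1 by rewrite gt_min; apply/orP; left; lra.
have sd : s < del by rewrite gt_min; apply/orP; right; lra.
have [q q0 tq] := rat_dense_time t0 s0.
have [z xz] := rat_dense_row x s0.
exists (fun n => iter (steps (ratr q) n) (I_ n) g (xs (map_mx ratr z) n)).
  exact: conv.
have [Xx xx] := xsP x; have [Xz zz] := xsP (map_mx ratr z).
have qT : ratr q <= t + 1.
  move: tq; rewrite distrC => /ler_normlP[_]; rewrite lerBlDl => /le_trans; apply.
  by rewrite lerD2l ltW.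
near=> n.
have -> : iter (steps t n) (I_ n) f (xs x n) -
    iter (steps (ratr q) n) (I_ n) g (xs (map_mx ratr z) n) =
  (iter (steps t n) (I_ n) f (xs x n) -
    iter (steps (ratr q) n) (I_ n) f (xs (map_mx ratr z) n)) +
  (iter (steps (ratr q) n) (I_ n) f (xs (map_mx ratr z) n) -
    iter (steps (ratr q) n) (I_ n) g (xs (map_mx ratr z) n)) by ring.
have zr : `|xs (map_mx ratr z) n| <= `|x| + 1.
  near: n; apply: near_ball zz _.
  rewrite -(subrK x (map_mx _ _)) addrC (le_lt_trans (ler_normD _ _))// ltrD2l.
  by rewrite distrC (le_lt_trans xz).
have qn := steps_le n q0.
rewrite (splitr e) (le_trans (ler_normD _ _))// lerD//.
  have M : forall k j x0 y, k%:R * h n <= t + 1 -> j%:R * h n <= t + 1 ->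
      `|k%:R * h n - j%:R * h n| <= del -> X n x0 -> X n y ->
      `|x0| <= `|x| + 1 -> `|y| <= `|x| + 1 -> `|x0 - y| <= del ->
      `|iter k (I_ n) f x0 - iter j (I_ n) f y| <= e / 2 by near: n.
  apply: M => //.
  - by rewrite (le_trans (steps_le n t0))// lerDl.
  - by rewrite (le_trans qn).
  - near: n; apply: near_dist (steps_cvg t0) (steps_cvg q0) _.
    exact: le_lt_trans tq sd.
  - by near: n; apply: near_ball xx _; rewrite ltrDl.
  - by near: n; apply: near_dist xx zz _; exact: le_lt_trans xz sd.
have M : forall k y, k%:R * h n <= t + 1 -> X n y -> `|y| <= `|x| + 1 ->
    `|iter k (I_ n) f y - iter k (I_ n) g y| <= e / 2.
  by near: n; apply: Hg => //; exact: bcvg_cst.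
by apply: M => //; rewrite (le_trans qn).
Unshelve. all: by end_near. Qed.

(** The iterates live on [X n], which need not contain [x]; hence the evaluation
    at the approximating points [xs x n]. *)
Definition St (t : R) f : V -> R :=
  fun x => limn (fun n => iter (steps t n) (I_ n) f (xs x n)).

(** Independence of all choices: two competing sequences differ by a quantity
    that the asymptotic equicontinuity makes vanish. *)
Lemma St_lim r u f t (k : nat -> nat) (y : nat -> V) (x : V) : bcvg r u f ->
  0 <= t -> (k n)%:R * h n @[n --> \oo] --> t -> (forall n, X n (y n)) ->
  y n @[n --> \oo] --> x ->
  iter (k n) (I_ n) (u n) (y n) @[n --> \oo] --> St t f x.
Proof.
move=> au t0 kt Xy yx; have [r0 Ef fr _ _ _] := au.
have af := bcvg_cst X Ef r0 fr.
apply/cvgrPdist_le => e e0; have e20 : 0 < e / 2 by rewrite divr_gt0.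
have T0 : 0 <= t + 1 by rewrite addr_ge0.
have [del del0 Hm] := equicontinuity sc (`|x| + 1) af au T0 e20.
have [Xx xx] := xsP x.
near=> n.
have -> : St t f x - iter (k n) (I_ n) (u n) (y n) =
  (St t f x - iter (steps t n) (I_ n) f (xs x n)) +
  (iter (steps t n) (I_ n) f (xs x n) - iter (k n) (I_ n) (u n) (y n)) by ring.
rewrite (splitr e) (le_trans (ler_normD _ _))// lerD//.
  by near: n; move/cvgrPdist_le : (limit_exists (x := x) Ef t0); apply.
have M : forall k j x0 y, k%:R * h n <= t + 1 -> j%:R * h n <= t + 1 ->
    `|k%:R * h n - j%:R * h n| <= del -> X n x0 -> X n y ->
    `|x0| <= `|x| + 1 -> `|y| <= `|x| + 1 -> `|x0 - y| <= del ->
    `|iter k (I_ n) f x0 - iter j (I_ n) (u n) y| <= e / 2 by near: n.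
apply: M => //.
- by rewrite (le_trans (steps_le n t0))// lerDl.
- by near: n; apply: (cvgr_le _ kt); rewrite ltrDl.
- by near: n; apply: near_dist (steps_cvg t0) kt _; rewrite subrr normr0.
- by near: n; apply: near_ball xx _; rewrite ltrDl.
- by near: n; apply: near_ball yx _; rewrite ltrDl.
- by near: n; apply: near_dist xx yx _; rewrite subrr normr0.
Unshelve. all: by end_near. Qed.

Lemma St_steps f t x : E f -> 0 <= t ->
  iter (steps t n) (I_ n) f (xs x n) @[n --> \oo] --> St t f x.
Proof. by move=> Ef t0; exact: limit_exists. Qed.

Lemma St_equicontinuity f T rho eps : E f -> 0 <= T -> 0 < eps -> exists2 del, 0 < del &
  forall s t x y, 0 <= s <= T -> 0 <= t <= T -> `|s - t| < del ->
    `|x| <= rho -> `|y| <= rho -> `|x - y| < del ->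
    `|St s f x - St t f y| <= eps.
Proof.
move=> Ef T0 e0; have af := bcvg_knorm sc Ef.
have [del del0 Hm] := equicontinuity sc (rho + 1) af af T0 e0.
exists del => // s t x y /andP[s0 sT] /andP[t0 tT] st xr yr xy.
have [Xx xx] := xsP x; have [Xy yy] := xsP y.
have c : `|iter (steps s n) (I_ n) f (xs x n) - iter (steps t n) (I_ n) f (xs y n)|
    @[n --> \oo] --> `|St s f x - St t f y|.
  exact: cvg_norm (cvgB (St_steps (x := x) Ef s0) (St_steps (x := y) Ef t0)).
apply: (cvgr_to_le c); near=> n.
have M : forall k j x0 y, k%:R * h n <= T -> j%:R * h n <= T ->
    `|k%:R * h n - j%:R * h n| <= del -> X n x0 -> X n y ->
    `|x0| <= rho + 1 -> `|y| <= rho + 1 -> `|x0 - y| <= del ->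
    `|iter k (I_ n) f x0 - iter j (I_ n) f y| <= eps by near: n.
apply: M => //.
- by rewrite (le_trans (steps_le n s0)).
- by rewrite (le_trans (steps_le n t0)).
- by near: n; exact: near_dist (steps_cvg s0) (steps_cvg t0) _.
- by near: n; apply: near_ball xx _; rewrite (le_lt_trans xr)// ltrDl.
- by near: n; apply: near_ball yy _; rewrite (le_lt_trans yr)// ltrDl.
- by near: n; exact: near_dist xx yy _.
Unshelve. all: by end_near. Qed.

Lemma St_continuous f t : E f -> 0 <= t -> continuous (St t f).
Proof.
move=> Ef t0 x; apply/(@cvgrPdist_le _ _ _ _ (nbhs_filter x)) => e e0.
have [del del0 H] := St_equicontinuity (`|x| + 1) Ef t0 e0.
apply/nbhs_ballP; exists (Num.min 1 del); first by rewrite /= lt_min ltr01.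
move=> y; rewrite -ball_normE /= lt_min => /andP[y1 yd].
apply: H; rewrite ?lexx ?t0 ?subrr ?normr0 ?lerDl//.
rewrite -(subrK x y) addrC (le_trans (ler_normD _ _))// lerD2l.
by rewrite distrC ltW.
Qed.

Let wk := sc_weight sc.
Let k0 x : 0 < kappa x. Proof. exact: weight_gt0 wk x. Qed.

Lemma kappa_cvg (y : nat -> V) (x : V) : y n @[n --> \oo] --> x ->
  kappa (y n) @[n --> \oo] --> kappa x.
Proof. by move=> yx; exact: (cvg_comp _ _ yx (weight_continuous wk (x := x))). Qed.

Lemma St_wleB f g b t : E f -> E g -> 0 <= t -> 0 <= b ->
  wle kappa setT (f - g) b ->
  wle kappa setT (St t f - St t g) (expR (omega * t) * b).
Proof.
move=> Ef Eg t0 b0 H x _; have [Xx xx] := xsP x.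
have c : `|iter (steps t n) (I_ n) f (xs x n) - iter (steps t n) (I_ n) g (xs x n)|
    @[n --> \oo] --> `|St t f x - St t g x|.
  exact: cvg_norm (cvgB (St_steps (x := x) Ef t0) (St_steps (x := x) Eg t0)).
apply: (cvgr_to_le (cvgM c (kappa_cvg xx))); near=> n.
have Hn : wle kappa (X n) (f - g) b by move=> y _; exact: H.
have := iter_lip sc (steps t n) (Ckappa_restrict _ Ef) (Ckappa_restrict _ Eg) b0 Hn.
move=> /(_ _ (Xx n))/le_trans; apply.
by rewrite ler_wpM2r// (ler_expRM (sc_omega sc))// steps_le.
Unshelve. all: by end_near. Qed.

Lemma St_zero t : 0 <= t -> St t 0 = 0.
Proof.
move=> t0; apply/funext => x; apply/cvg_lim => //.
rewrite [X in X @ _ --> _](_ : _ = fun=> 0); first exact: cvg_cst.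
by apply/funext => n; rewrite (iter_zero sc)//; exact: (xsP x).1.
Qed.

Lemma St_wle f b t : E f -> 0 <= t -> 0 <= b -> wle kappa setT f b ->
  wle kappa setT (St t f) (expR (omega * t) * b).
Proof.
move=> Ef t0 b0 H; rewrite -[St t f]subr0 -(St_zero t0).
by apply: St_wleB => //; [exact: Ckappa0|rewrite subr0].
Qed.

Lemma St_Ckappa f t : E f -> 0 <= t -> E (St t f).
Proof.
move=> Ef t0; split; first by apply: continuous_subspaceT; exact: St_continuous.
exists (expR (omega * t) * knorm kappa setT f).
by apply: St_wle => //; [exact: knorm_ge0|exact: wle_knorm].
Qed.

(** Pointwise convergence becomes locally uniform: near [x] both the iterates
    and their limit vary little, and finitely many such neighbourhoods cover a
    ball. *)
Lemma St_loc r u f t (k : nat -> nat) : bcvg r u f -> 0 <= t ->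
  (k n)%:R * h n @[n --> \oo] --> t ->
  loc_cvg X (fun n => iter (k n) (I_ n) (u n)) (St t f).
Proof.
move=> au t0 kt rho eps e0; have [r0 Ef _ _ _ _] := au.
have e30 : 0 < eps / 3 by rewrite divr_gt0.
have T0 : 0 <= t + 1 by rewrite addr_ge0.
pose P n x := X n x -> `|iter (k n) (I_ n) (u n) x - St t f x| <= eps.
have H : \forall n \near \oo, nball rho `<=` P n.
  apply: (iffLR (compact_near_coveringP _) (@compact_nball R d rho)) => x /= xr.
  have [Xx xx] := xsP x.
  have [del del0 Hm] := equicontinuity sc (`|x| + 1) au au T0 e30.
  have [del' del'0 Hm'] := St_equicontinuity (`|x| + 1) Ef t0 e30.
  have p0 : 0 < Num.min 1 (Num.min (del / 2) del').
    by rewrite !lt_min ltr01 del'0 divr_gt0.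
  near=> x' n => Xx'.
  have : `|x - x'| < Num.min 1 (Num.min (del / 2) del').
    by near: x'; apply/nbhs_ballP; exists (Num.min 1 (Num.min (del / 2) del')) => //= z;
      rewrite -ball_normE.
  rewrite !lt_min => /and3P[x1 xd xd'].
  have x'r : `|x'| <= `|x| + 1.
    rewrite -(subrK x x') addrC (le_trans (ler_normD _ _))// lerD2l.
    by rewrite distrC ltW.
  have -> : iter (k n) (I_ n) (u n) x' - St t f x' =
    (iter (k n) (I_ n) (u n) x' - iter (k n) (I_ n) (u n) (xs x n)) -
    (St t f x - iter (k n) (I_ n) (u n) (xs x n)) +
    (St t f x - St t f x') by ring.
  have -> : eps = eps / 3 + eps / 3 + eps / 3 by field.
  rewrite (le_trans (ler_normD _ _))// lerD//; last first.
    by apply: Hm' => //; rewrite ?t0 ?lexx ?subrr ?normr0 ?lerDl.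
  rewrite (le_trans (ler_normB _ _))// lerD//; last first.
    by near: n; move/cvgrPdist_le : (St_lim au t0 kt Xx xx); apply.
  have M : forall k j x0 y, k%:R * h n <= t + 1 -> j%:R * h n <= t + 1 ->
      `|k%:R * h n - j%:R * h n| <= del -> X n x0 -> X n y ->
      `|x0| <= `|x| + 1 -> `|y| <= `|x| + 1 -> `|x0 - y| <= del ->
      `|iter k (I_ n) (u n) x0 - iter j (I_ n) (u n) y| <= eps / 3 by near: n.
  have kn : (k n)%:R * h n <= t + 1.
    by near: n; apply: (cvgr_le _ kt); rewrite ltrDl.
  apply: M => //.
  - by rewrite subrr normr0 ltW.
  - by near: n; apply: near_ball xx _; rewrite ltrDl.
  - rewrite -(subrK x x') -addrA (splitr del) (le_trans (ler_normD _ _))//.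
    rewrite lerD// 1?distrC ?(ltW xd)//.
    near: n; apply: near_dist xx (cvg_cst x) _.
    by rewrite subrr normr0 divr_gt0.
by apply: filterS H => n Hn x Xx xr; exact: (Hn x xr Xx).
Unshelve. all: by end_near. Qed.


Lemma bcvg_pointwise r u f (y : nat -> V) x : bcvg r u f -> (forall n, X n (y n)) ->
  y n @[n --> \oo] --> x -> u n (y n) @[n --> \oo] --> f x.
Proof.
move=> au Xy yx; apply/cvgrPdist_le => e e0; have e20 : 0 < e / 2 by rewrite divr_gt0.
have fy : f (y n) @[n --> \oo] --> f x.
  exact: (cvg_comp _ _ yx (Ckappa_continuous (bcvg_lim au) (x := x))).
near=> n; have -> : f x - u n (y n) = (f x - f (y n)) - (u n (y n) - f (y n)) by ring.
rewrite (splitr e) (le_trans (ler_normB _ _))// lerD//.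
  by near: n; move/cvgrPdist_le : fy; apply.
have yr : `|y n| <= `|x| + 1 by near: n; apply: near_ball yx _; rewrite ltrDl.
have un : forall z, X n z -> `|z| <= `|x| + 1 -> `|u n z - f z| <= e / 2.
  by near: n; exact: (bcvg_cvg au).
exact: un.
Unshelve. all: by end_near. Qed.

Lemma St0 f : E f -> St 0 f = f.
Proof.
move=> Ef; apply/funext => x; apply/cvg_lim => //.
rewrite [X in X @ _ --> _](_ : _ = fun n => f (xs x n)).
  exact: bcvg_pointwise (bcvg_knorm sc Ef) (xsP x).1 (xsP x).2.
by apply/funext => n; rewrite /steps mul0r truncn0.
Qed.

Lemma St_bcvg r u f t (k : nat -> nat) : bcvg r u f -> 0 <= t ->
  (k n)%:R * h n @[n --> \oo] --> t ->
  exists s, bcvg s (fun n => iter (k n) (I_ n) (u n)) (St t f).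
Proof.
move=> au t0 kt; have [r0 Ef fr Eu ur _] := au.
have /cvg_seq_bounded[N [_ HN]] : cvgn (fun n => (k n)%:R * h n) by apply/cvg_ex; exists t.
have kN n : (k n)%:R * h n <= N + 1.
  by rewrite (le_trans (ler_norm _))//; apply: (HN (N + 1) _ n I); rewrite ltrDl.
exists (expR (omega * Num.max t (N + 1)) * r); split.
- by rewrite mulr_ge0// expR_ge0.
- exact: St_Ckappa.
- apply: wle_le (St_wle Ef t0 r0 fr).
  by rewrite ler_wpM2r// (ler_expRM (sc_omega sc))// le_max lexx.
- by move=> n; exact: (iter_Ckappa sc).
- move=> n; apply: wle_le (iter_norm sc (k n) (Eu n) r0 (ur n)).
  by rewrite ler_wpM2r// (ler_expRM (sc_omega sc))// le_max kN orbT.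
- exact: St_loc au t0 kt.
Qed.

Lemma St_add s t f : 0 <= s -> 0 <= t -> E f -> St (s + t) f = St s (St t f).
Proof.
move=> s0 t0 Ef; apply/funext => x; have [Xx xx] := xsP x.
have af := bcvg_knorm sc Ef.
have [r ar] := St_bcvg af t0 (steps_cvg t0).
(* The two limits of the same sequence: as [I^k] applied to the approximants
   [I^j f] of [St t f], and as [I^(k+j)] applied to [f]. *)
have c1 := St_lim ar s0 (steps_cvg s0) Xx xx.
have kst : (steps s n + steps t n)%N%:R * h n @[n --> \oo] --> s + t.
  rewrite [X in X @ _ --> _](_ : _ = fun n => (steps s n)%:R * h n + (steps t n)%:R * h n).
    exact: cvgD (steps_cvg s0) (steps_cvg t0).
  by apply/funext => n; rewrite natrD mulrDl.
have c2 : iter (steps s n + steps t n) (I_ n) f (xs x n) @[n --> \oo] --> St (s + t) f x.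
  exact: St_lim af (addr_ge0 s0 t0) kst Xx xx.
have e1 : (fun n => iter (steps s n + steps t n) (I_ n) f (xs x n)) =
    (fun n => iter (steps s n) (I_ n) (iter (steps t n) (I_ n) f) (xs x n)).
  by apply/funext => n; rewrite iterD.
rewrite e1 in c2.
by rewrite -(cvg_lim _ c2)// -(cvg_lim _ c1).
Qed.

Lemma St_mono t : 0 <= t -> monotone_op kappa setT (St t).
Proof.
move=> t0 f g Ef Eg fg x _.
apply: (ler_cvg_to (St_steps (x := x) Ef t0) (St_steps (x := x) Eg t0)).
near=> n; apply: (iter_mono sc); [exact: Ckappa_restrict|exact: Ckappa_restrict| |].
  by move=> y _; exact: fg.
exact: (xsP x).1.
Unshelve. all: by end_near. Qed.

Lemma St_convex t : 0 <= t -> convex_op kappa setT (St t).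
Proof.
move=> t0 f g l Ef Eg l01 x _.
have El : E (l *: f + (1 - l) *: g) by apply: CkappaD => //; exact: CkappaZ.
have c : l * iter (steps t n) (I_ n) f (xs x n) +
    (1 - l) * iter (steps t n) (I_ n) g (xs x n) @[n --> \oo] -->
    l * St t f x + (1 - l) * St t g x.
  exact: cvgD (cvgM (cvg_cst _) (St_steps (x := x) Ef t0))
              (cvgM (cvg_cst _) (St_steps (x := x) Eg t0)).
apply: (ler_cvg_to (St_steps (x := x) El t0) c).
near=> n; apply: (iter_convex sc) => //; try exact: Ckappa_restrict.
exact: (xsP x).1.
Unshelve. all: by end_near. Qed.

Lemma St_local eps r T rho : 0 < eps -> 0 <= r -> 0 <= T ->
  exists c rho' : R, 0 <= c /\ forall t f g b, 0 <= t <= T ->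
    E f -> wle kappa setT f r -> E g -> wle kappa setT g r -> 0 <= b ->
    (forall y, `|y| <= rho' -> `|f y - g y| <= b) ->
    forall x, `|x| <= rho -> `|St t f x - St t g x| <= c * b + eps.
Proof.
move=> e0 r0 T0; have [c [rho' [c0 Hc]]] := sc_local sc (rho + 1) e0 r0 T0.
exists c, rho'; split => // t f g b /andP[t0 tT] Ef fr Eg gr b0 fg x xr.
have [Xx xx] := xsP x.
have cv : `|iter (steps t n) (I_ n) f (xs x n) - iter (steps t n) (I_ n) g (xs x n)|
    @[n --> \oo] --> `|St t f x - St t g x|.
  exact: cvg_norm (cvgB (St_steps (x := x) Ef t0) (St_steps (x := x) Eg t0)).
apply: (cvgr_to_le cv); near=> n; apply: Hc => //.
- exact: le_trans (steps_le n t0) tT.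
- exact: Ckappa_restrict.
- by move=> y _; exact: fr.
- exact: Ckappa_restrict.
- by move=> y _; exact: gr.
- by move=> y _; exact: fg.
- by near: n; apply: near_ball xx _; rewrite (le_lt_trans xr)// ltrDl.
Unshelve. all: by end_near. Qed.

(** By Dini the functions are uniformly small on the ball that the local
    equicontinuity at [x] asks for. *)
Lemma St_above t (fn : nat -> V -> R) : 0 <= t -> (forall n, E (fn n)) ->
  decreases_to fn 0 -> decreases_to (fun n => St t (fn n)) 0.
Proof.
move=> t0 Efn dfn; have [dec fn0] := dfn; split.
  by move=> n x; apply: (St_mono t0) => // y _; exact: dec.
move=> x; apply/cvgr0Pnorm_le => e e0.
have e20 : 0 < e / 2 by rewrite divr_gt0.
have mono y := decreases_to_homo y dfn.
have ge0 n y : 0 <= fn n y := decreases_to_ge n y dfn.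
have r0 := @knorm_ge0 _ _ kappa setT (fn 0%N) k0.
have fnr n : wle kappa setT (fn n) (knorm kappa setT (fn 0%N)).
  move=> y _; apply: le_trans (wle_knorm (Efn 0%N) (I : setT y)).
  by rewrite ler_wpM2r ?(ltW (k0 y))// !ger0_norm// mono.
have [c [rho' [c0 Hc]]] := St_local `|x| e20 r0 t0.
have c1 : 0 < c + 1 by rewrite ltr_wpDl.
have eta0 : 0 < e / 2 / (c + 1) by rewrite divr_gt0.
have D := dini rho' (fun n => Ckappa_continuous (Efn n)) dfn eta0.
near=> n.
have -> : St t (fn n) x = St t (fn n) x - St t 0 x by rewrite St_zero// subr0.
apply: (le_trans (Hc t (fn n) 0 (e / 2 / (c + 1)) _ _ _ _ _ _ _ x _)) => //.
- by rewrite t0 lexx.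
- exact: Ckappa0.
- by move=> y _; rewrite normr0 mul0r.
- exact: ltW.
- by move=> y yr; rewrite subr0; move: y yr; near: n.
- rewrite [leRHS]splitr lerD// mulrA ler_pdivrMr// mulrC ler_wpM2l ?(ltW e20)//.
  by rewrite lerDl.
Unshelve. all: by end_near. Qed.

Lemma St_Lip r t f : 0 <= r -> 0 <= t -> Lip_br setT r f ->
  Lip_br setT (expR (omega * t) * r) (St t f).
Proof.
move=> r0 t0 Lf; have Ef : E f by exact: Lip_br_Ckappa Lf.
have Lfn n : Lip_br (X n) r f.
  by have [L M] := Lf; split => [x y _ _|x _]; [exact: L|exact: M].
have eT n : expR (omega * ((steps t n)%:R * h n)) * r <= expR (omega * t) * r.
  by rewrite ler_wpM2r// (ler_expRM (sc_omega sc))// steps_le.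
split=> [x y _ _|x _]; have [Xx xx] := xsP x.
  have [Xy yy] := xsP y.
  have c1 : `|iter (steps t n) (I_ n) f (xs x n) - iter (steps t n) (I_ n) f (xs y n)|
      @[n --> \oo] --> `|St t f x - St t f y|.
    exact: cvg_norm (cvgB (St_steps (x := x) Ef t0) (St_steps (x := y) Ef t0)).
  have c2 : expR (omega * t) * r * enorm (xs x n - xs y n) @[n --> \oo] -->
      expR (omega * t) * r * enorm (x - y).
    apply: cvgM; first exact: cvg_cst.
    exact: (cvg_comp _ _ (cvgB xx yy) (@enorm_continuous R d (x - y))).
  apply: (ler_cvg_to c1 c2); near=> n.
  have [/(_ _ _ (Xx n) (Xy n))/le_trans + _] := iter_Lip sc (steps t n) r0 (Lfn n).
  by apply; rewrite ler_wpM2r// sqrtr_ge0.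
apply: (cvgr_to_le (cvg_norm (St_steps (x := x) Ef t0))); near=> n.
by have [_ /(_ _ (Xx n))/le_trans] := iter_Lip sc (steps t n) r0 (Lfn n); apply.
Unshelve. all: by end_near. Qed.

Lemma St_mixed_continuous f : E f -> mixed_cvg kappa 0^'+ (fun t => St t f) f.
Proof.
move=> Ef; have r0 := knorm_ge0 setT f k0; set r := knorm _ _ _ in r0.
apply: (@mixed_cvg_bounded_loc R d kappa R 0^'+ (fun t => St t f) f (expR (omega * 1) * r) _ Ef).
  near=> t; have t0 : 0 <= t by near: t; exact: nbhs_right_ge.
  split; first exact: St_Ckappa.
  apply: wle_le (St_wle Ef t0 r0 (wle_knorm Ef)).
  rewrite ler_wpM2r// (ler_expRM (sc_omega sc))//.
  by near: t; exact: nbhs_right_le.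
move=> rho eps e0.
have [del del0 H] := St_equicontinuity rho Ef ler01 e0.
near=> t => x xr; have t0 : 0 <= t by near: t; exact: nbhs_right_ge.
(* Compare the times [t] and 0. *)
rewrite -[X in _ - X x](St0 Ef); apply: H; rewrite ?lexx ?ler01 ?subrr ?normr0//.
  by rewrite t0; near: t; exact: nbhs_right_le.
by rewrite subr0 ger0_norm//; near: t; exact: nbhs_right_lt.
Unshelve. all: by end_near. Qed.

Lemma St_semigroup : sc_convex_monotone_semigroup kappa St.
Proof.
split.
- move=> t t0; split; first by move=> f Ef; exact: St_Ckappa.
  by move=> f g _ _ fg x _; have -> : f = g by apply/funext => y; exact: fg.
- exact: St_convex.
- exact: St_mono.
- exact: St_above.
- exact: St0.
- by move=> s t f; exact: St_add.
- move=> r T r0 T0; exists (expR (omega * T) * r) => t /andP[t0 tT].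
  have ri : wle kappa setT (fun x => r / kappa x) r.
    move=> x _; rewrite ger0_norm ?divr_ge0 ?(ltW (k0 x))//.
    by rewrite divfK// gt_eqF.
  have Er : E (fun x => r / kappa x).
    split; last by exists r.
    apply: continuous_subspaceT => x; apply: (@cvgM _ _ _ (nbhs_filter x)).
      exact: cvg_cst.
    by apply: (@cvgV _ _ _ (nbhs_filter x)); [rewrite gt_eqF|exact: weight_continuous].
  apply: knorm_le; first by rewrite mulr_ge0// expR_ge0.
  apply: wle_le (St_wle Er t0 r0 ri).
  by rewrite ler_wpM2r// (ler_expRM (sc_omega sc)).
- exact: St_mixed_continuous.
Qed.

(** * The generator *)

(** This bounds the difference quotients of [St] at 0 in the weighted norm, as
    mixed convergence requires. *)
Lemma St_time r q u f t : bcvg r u f -> 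
  (forall n, wle kappa (X n) (I_ n (u n) - u n) (h n * q)) -> 0 <= q -> 0 <= t ->
  wle kappa setT (St t f - f) (t * (expR (omega * t) * q)).
Proof.
move=> au uq q0 t0 x _; have [Xx xx] := xsP x.
have c : `|iter (steps t n) (I_ n) (u n) (xs x n) - u n (xs x n)|
    @[n --> \oo] --> `|St t f x - f x|.
  exact: cvg_norm (cvgB (St_lim au t0 (steps_cvg t0) Xx xx) (bcvg_pointwise au Xx xx)).
apply: (cvgr_to_le (cvgM c (kappa_cvg xx))); near=> n.
have := iter_time sc (steps t n) (bcvg_seq au n) q0 (uq n) => /(_ _ (Xx n)).
move/le_trans; apply; have h0 := sc_gt0 sc n; apply: ler_pM; rewrite ?mulr_ge0 ?expR_ge0 ?(ltW h0)//.
  exact: steps_le.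
by rewrite ler_wpM2r// (ler_expRM (sc_omega sc))// steps_le.
Unshelve. all: by end_near. Qed.

Lemma bcvgD r s u v f g : bcvg r u f -> bcvg s v g ->
  bcvg (r + s) (fun n => u n + v n) (f + g).
Proof.
move=> [r0 Ef fr Eu ur uf] [s0 Eg gs Ev vs vg]; split.
- exact: addr_ge0.
- exact: CkappaD.
- exact: (wleD wk).
- by move=> n; exact: CkappaD.
- by move=> n; exact: (wleD wk).
- move=> rho eps e0; have e20 : 0 < eps / 2 by rewrite divr_gt0.
  apply: filterS2 (uf rho _ e20) (vg rho _ e20) => n Hu Hv x Xx xr.
  have -> : (u n + v n) x - (f + g) x = (u n x - f x) + (v n x - g x).
    by change (u n x + v n x - (f x + g x) = (u n x - f x) + (v n x - g x)); ring.
  by rewrite (splitr eps) (le_trans (ler_normD _ _))// lerD ?Hu ?Hv.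
Qed.

Lemma bcvgN r u f : bcvg r u f -> bcvg r (fun n => - u n) (- f).
Proof.
move=> [r0 Ef fr Eu ur uf]; split=> //.
- by rewrite -scaleN1r; exact: CkappaZ.
- by move=> x _; rewrite [(- f) x]/(- (f x)) normrN; exact: fr.
- by move=> n; rewrite -scaleN1r; exact: CkappaZ.
- by move=> n x Xx; rewrite [(- u n) x]/(- (u n x)) normrN; exact: ur.
- move=> rho eps e0; apply: filterS (uf rho _ e0) => n Hu x Xx xr.
  rewrite [(- u n) x]/(- (u n x)) [(- f) x]/(- (f x)) -opprD normrN.
  exact: Hu.
Qed.

Definition step_quotient u n : V -> R := (h n)^-1 *: (I_ n (u n) - u n).

Lemma stepE u n : I_ n (u n) = u n + h n *: step_quotient u n.
Proof.
by rewrite /step_quotient scalerA divff ?scale1r 1?addrC ?subrK// gt_eqF// (sc_gt0 sc).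
Qed.

(** Both bounds are convexity of [I^k], applied to
    [I u = h (u + q) + (1 - h) u] and to [u = h (I u - q) + (1 - h) I u], where
    [q] is the difference quotient; [h <= 1] makes these convex combinations. *)
Lemma increment_bounds u n k x : h n <= 1 -> Ckappa kappa (X n) (u n) ->
  X n x ->
  h n * (iter k (I_ n) (I_ n (u n)) x -
         iter k (I_ n) (I_ n (u n) - step_quotient u n) x) <=
  iter k.+1 (I_ n) (u n) x - iter k (I_ n) (u n) x <=
  h n * (iter k (I_ n) (u n + step_quotient u n) x - iter k (I_ n) (u n) x).
Proof.
move=> h1 Eu Xx; have h0 := sc_gt0 sc n; set q := step_quotient u n.
have EI : Ckappa kappa (X n) (I_ n (u n)) by exact: (op_maps (sc_op sc n)).
have Eq : Ckappa kappa (X n) q by apply: CkappaZ; exact: CkappaB.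
have h01 : 0 <= h n <= 1 by rewrite h1 ltW.
have Iu : I_ n (u n) = u n + h n *: q by exact: stepE.
apply/andP; split.
  have EIq : Ckappa kappa (X n) (I_ n (u n) - q) by exact: CkappaB.
  have := iter_convex sc k EIq EI h01 Xx.
  have -> : h n *: (I_ n (u n) - q) + (1 - h n) *: I_ n (u n) = u n.
    rewrite Iu; apply/funext => y.
    change (h n * (u n y + h n * q y - q y) + (1 - h n) * (u n y + h n * q y) = u n y).
    by ring.
  rewrite iterSr; move: (iter _ _ _ x) (iter _ _ _ x) (iter _ _ _ x) => a b c.
  by move=> H; lra.
have Euq : Ckappa kappa (X n) (u n + q) by exact: CkappaD.
have := iter_convex sc k Euq Eu h01 Xx.
have -> : h n *: (u n + q) + (1 - h n) *: u n = I_ n (u n).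
  rewrite Iu; apply/funext => y.
  change (h n * (u n y + q y) + (1 - h n) * u n y = u n y + h n * q y).
  by ring.
rewrite iterSr; move: (iter _ _ _ x) (iter _ _ _ x) (iter _ _ _ x) => a b c.
by move=> H; lra.
Qed.

(** Equicontinuity between the times [k h] and 0, at the same point. *)
Lemma initial_continuity r u f rho eps : bcvg r u f -> 0 < eps ->
  exists2 del, 0 < del & \forall n \near \oo, forall k x, k%:R * h n <= del ->
    X n x -> `|x| <= rho -> `|iter k (I_ n) (u n) x - u n x| <= eps.
Proof.
move=> au e0; have [del del0 H] := equicontinuity sc rho au au ler01 e0.
exists (Num.min 1 del); first by rewrite lt_min ltr01.
apply: filterS H => n Hn k x; rewrite le_min => /andP[k1 kd] Xx xr.
have h0 := sc_gt0 sc n.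
apply: (Hn k 0 x x) => //; rewrite ?mul0r ?ler01// ?subr0 ?subrr ?normr0 ?(ltW del0)//.
by rewrite ger0_norm// mulr_ge0// ltW.
Qed.

(** [I^k] is close to the identity on [u], [u + q], [I u] and [I u - q], so the
    convexity bounds on one increment are both [h (g + O(eps))]; the errors add
    up to [k h eps] over [k] steps.  That [I u] converges to [f] like [u] is the
    case of one step, at time 0. *)
Lemma increment_estimate r u f g rho eps : bcvg r u f -> bcvg r (step_quotient u) g ->
  0 < eps -> exists2 del, 0 < del & \forall n \near \oo, forall k x,
    k%:R * h n <= del -> X n x -> `|x| <= rho ->
    `|iter k (I_ n) (u n) x - u n x - k%:R * h n * g x| <= k%:R * h n * eps.
Proof.
move=> au aq e0; have e30 : 0 < eps / 3 by rewrite divr_gt0.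
have k1 : 1%N%:R * h n @[n --> \oo] --> 0.
  rewrite [X in X @ _ --> _](_ : _ = h); first exact: sc_to0 sc.
  by apply/funext => n; rewrite mul1r.
have [s] := St_bcvg (k := fun=> 1%N) au (lexx 0) k1.
rewrite (St0 (bcvg_lim au)) /= => aI.
have [d1 d10 H1] := initial_continuity rho au e30.
have [d2 d20 H2] := initial_continuity rho (bcvgD au aq) e30.
have [d3 d30 H3] := initial_continuity rho aI e30.
have [d4 d40 H4] := initial_continuity rho (bcvgD aI (bcvgN aq)) e30.
pose del := Num.min (Num.min d1 d2) (Num.min d3 d4).
exists del; first by rewrite !lt_min d10 d20 d30.
near=> n => k x kd Xx xr; have h0 := sc_gt0 sc n.
have h1 : h n <= 1 by near: n; apply: (cvgr_le _ (sc_to0 sc)); exact: ltr01.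
have inc j : j%:R * h n <= del ->
    `|iter j.+1 (I_ n) (u n) x - iter j (I_ n) (u n) x - h n * g x| <= h n * eps.
  rewrite !le_min => /andP[/andP[j1 j2] /andP[j3 j4]].
  have E1 : `|iter j (I_ n) (u n) x - u n x| <= eps / 3.
    by move: j x j1 {j2 j3 j4 kd} Xx xr; near: n.
  have E2 : `|iter j (I_ n) (u n + step_quotient u n) x - (u n + step_quotient u n) x| <= eps / 3.
    by move: j x j2 {j1 j3 j4 kd E1} Xx xr; near: n.
  have E3 : `|iter j (I_ n) (I_ n (u n)) x - (I_ n (u n)) x| <= eps / 3.
    by move: j x j3 {j1 j2 j4 kd E1 E2} Xx xr; near: n.
  have E4 : `|iter j (I_ n) (I_ n (u n) - step_quotient u n) x -
      (I_ n (u n) - step_quotient u n) x| <= eps / 3.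
    by move: j x j4 {j1 j2 j3 kd E1 E2 E3} Xx xr; near: n.
  have E5 : `|step_quotient u n x - g x| <= eps / 3.
    by move: x Xx xr {E1 E2 E3 E4 kd}; near: n; exact: (bcvg_cvg aq).
  have := increment_bounds j h1 (bcvg_seq au n) Xx.
  have : `|iter j (I_ n) (u n + step_quotient u n) x - (u n x + step_quotient u n x)| <= eps / 3.
    exact: E2.
  have : `|iter j (I_ n) (I_ n (u n) - step_quotient u n) x -
      (I_ n (u n) x - step_quotient u n x)| <= eps / 3 by exact: E4.
  move: E1 E3 E5 => /ler_normlP[a1 a2] /ler_normlP[b1 b2] /ler_normlP[c1 c2].
  move=> /ler_normlP[q1 q2] /ler_normlP[p1 p2] /andP[lo up].
  set a := iter j.+1 _ _ x in up lo *; set b := iter j _ (u n) x in up lo a1 a2 *.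
  have up' : a - b <= h n * (g x + eps).
    by apply: (le_trans up); rewrite ler_wpM2l ?(ltW h0)//; lra.
  have lo' : h n * (g x - eps) <= a - b.
    by apply: le_trans lo; rewrite ler_wpM2l ?(ltW h0)//; lra.
  by apply/ler_normlP; split; lra.
elim: k kd => [|k IH] kd.
  by rewrite /= !mul0r subrr subr0 normr0.
have kd' : k%:R * h n <= del.
  by apply: le_trans kd; rewrite ler_wpM2r ?(ltW h0)// ler_nat.
have -> : iter k.+1 (I_ n) (u n) x - u n x - k.+1%:R * h n * g x =
  (iter k.+1 (I_ n) (u n) x - iter k (I_ n) (u n) x - h n * g x) +
  (iter k (I_ n) (u n) x - u n x - k%:R * h n * g x).
  by rewrite -natr1; ring.
rewrite (le_trans (ler_normD _ _))// (le_trans (lerD (inc k kd') (IH kd')))//.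
by rewrite -natr1 !mulrDl mul1r addrC.
Unshelve. all: by end_near. Qed.

Lemma generator_limit r u f g : bcvg r u f -> bcvg r (step_quotient u) g ->
  generator_lim kappa St f g.
Proof.
move=> au aq; have [r0 Ef fr _ _ _] := au; have [_ Eg gr Equ qr _] := aq.
split=> //.
apply: (@mixed_cvg_bounded_loc R d kappa R 0^'+ (fun t => t^-1 *: (St t f - f)) g
  (expR (omega * 1) * r) _ Eg).
  near=> t; have t0 : 0 < t by near: t; exact: nbhs_right_gt.
  have t1 : t <= 1 by near: t; exact: nbhs_right_le.
  have ESt : E (St t f - f) by apply: CkappaB => //; apply: St_Ckappa => //; exact: ltW.
  split; first exact: CkappaZ.
  have uq n : wle kappa (X n) (I_ n (u n) - u n) (h n * r).
    rewrite stepE addrC addKr => x Xx; rewrite [(_ *: _) x]/(h n * step_quotient u n x).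
    have h0 := sc_gt0 sc n.
    by rewrite normrM gtr0_norm// -mulrA ler_wpM2l ?(ltW h0)//; exact: qr.
  move=> x _; have /(_ x I) := St_time au uq r0 (ltW t0).
  rewrite [(t^-1 *: _) x]/(t^-1 * (St t f - f) x) normrM gtr0_norm ?invr_gt0//.
  rewrite -mulrA ler_pdivrMl// => /le_trans; apply.
  by rewrite ler_wpM2l ?(ltW t0)// ler_wpM2r// (ler_expRM (sc_omega sc)).
move=> rho eps e0.
have [del del0 H] := increment_estimate (rho + 1) au aq e0.
near=> t => x xr; have t0 : 0 < t by near: t; exact: nbhs_right_gt.
have td : t <= del by near: t; exact: nbhs_right_le.
rewrite [(t^-1 *: _) x]/(t^-1 * (St t f x - f x)).
have -> : t^-1 * (St t f x - f x) - g x = t^-1 * (St t f x - f x - t * g x).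
  by field; rewrite gt_eqF.
rewrite normrM gtr0_norm ?invr_gt0// ler_pdivrMl//.
have [Xx xx] := xsP x; have c0 := steps_cvg (ltW t0).
have cg : g (xs x n) @[n --> \oo] --> g x.
  exact: (cvg_comp _ _ xx (Ckappa_continuous Eg (x := x))).
have c1 : `|iter (steps t n) (I_ n) (u n) (xs x n) - u n (xs x n) -
    (steps t n)%:R * h n * g (xs x n)| @[n --> \oo] --> `|St t f x - f x - t * g x|.
  exact: cvg_norm (cvgB (cvgB (St_lim au (ltW t0) c0 Xx xx) (bcvg_pointwise au Xx xx))
    (cvgM c0 cg)).
apply: (cvgr_to_le c1); near=> n.
have xn : `|xs x n| <= rho + 1.
  by near: n; apply: near_ball xx _; rewrite (le_lt_trans xr)// ltrDl.
have sd : (steps t n)%:R * h n <= del by rewrite (le_trans (steps_le n (ltW t0))).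
apply: (@le_trans _ _ ((steps t n)%:R * h n * eps)).
  by move: sd (Xx n) xn; move: (steps t n) (xs x n); near: n.
by rewrite ler_wpM2r ?(ltW e0)// steps_le// ltW.
Unshelve. all: by end_near. Qed.

End Limit.

(** * Passage to the subsequence *)

Section Subsequence.
Context {R : realType} {d : nat} (kappa : 'rV[R]_d -> R) (h : nat -> R)
  (X : nat -> set 'rV[R]_d) (I_ : nat -> ('rV[R]_d -> R) -> 'rV[R]_d -> R)
  (omega : R) (D0 : set ('rV[R]_d -> R)) (sc : scheme kappa h X I_ omega D0).
Local Notation V := 'rV[R]_d.
Variable nl : nat -> nat.
Hypothesis nlP : {homo nl : i j / (i < j)%N}.

Lemma near_subseq (P : nat -> Prop) :
  (\forall n \near \oo, P n) -> \forall l \near \oo, P (nl l).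
Proof.
have le_nl l : (l <= nl l)%N.
  by elim: l => // l /leq_ltn_trans; apply; exact: nlP.
by move=> [N _ HN]; exists N => // l /= Nl; apply: HN => /=; rewrite (leq_trans Nl).
Qed.

Lemma cvg_subseq (T : topologicalType) (u : nat -> T) (a : T) :
  u n @[n --> \oo] --> a -> u (nl l) @[l --> \oo] --> a.
Proof. by move=> ua B /ua; exact: near_subseq. Qed.

Lemma loc_cvg_subseq (u : nat -> V -> R) (f : V -> R) : loc_cvg X u f ->
  loc_cvg (fun l => X (nl l)) (fun l => u (nl l)) f.
Proof. by move=> uf rho eps e0; exact: near_subseq (uf rho eps e0). Qed.

Lemma bcvg_subseq r (u : nat -> V -> R) (f : V -> R) : bcvg kappa X r u f ->
  bcvg kappa (fun l => X (nl l)) r (fun l => u (nl l)) f.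
Proof. by move=> [r0 Ef fr Eu ur uf]; split => //; exact: loc_cvg_subseq. Qed.

Lemma scheme_subseq : scheme kappa (fun l => h (nl l)) (fun l => X (nl l))
  (fun l => I_ (nl l)) omega D0.
Proof.
case: sc => wk h0 hto0 Xd Iop Iconv Imono I0 om0 Ilip Iloc ILip HD0 Hdense.
split => //.
- exact: cvg_subseq.
- move=> x; have [xn [Xxn xnx]] := Xd x; exists (fun l => xn (nl l)).
  by split => //; exact: cvg_subseq.
- by move=> n x; exact: I0.
- by move=> n; exact: Ilip.
- move=> eps r T rho e0 r0 T0; have [c [rho' [c0 H]]] := Iloc _ _ _ rho e0 r0 T0.
  by exists c, rho'; split => // k n; exact: H.
- by move=> n; exact: ILip.
- move=> f /HD0[Ef [r [fb [M [r0 M0 fbL fbf fbM]]]]]; split => //.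
  exists r, (fun l => fb (nl l)), M; split => //.
  exact: loc_cvg_subseq.
Qed.

End Subsequence.

(** The point [a] serves as the value at the integers that code no element. *)
Lemma countable_surjection {T : Type} (D : set T) (a : T) : D a -> countable D ->
  exists e : nat -> T, (forall m, D (e m)) /\ forall x, D x -> exists m, e m = x.
Proof.
move=> Da /countable_injP[F injF].
have /choice[e He] : forall m, exists x, D x /\ forall y, D y -> F y = m -> y = x.
  move=> m; have [[x [Dx Fx]]|no] := pselect (exists x, D x /\ F x = m).
    exists x; split => // y Dy Fy; apply: injF; rewrite ?inE//; exact: etrans Fy _.
  by exists a; split => // y Dy Fy; case: no; exists y.
exists e; split; first by move=> m; exact: (He m).1.
by move=> x Dx; exists (F x); exact: (esym ((He (F x)).2 x Dx erefl)).
Qed.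

(** The diagonal argument runs over the triples of an element of [D0], a rational
    time and a rational point, coded by one integer. *)
Lemma convergent_subsequence {R : realType} {d : nat} (kappa : 'rV[R]_d -> R)
    (h : nat -> R) (X : nat -> set 'rV[R]_d)
    (I_ : nat -> ('rV[R]_d -> R) -> 'rV[R]_d -> R) (omega : R)
    (D0 : set ('rV[R]_d -> R)) (xs : 'rV[R]_d -> nat -> 'rV[R]_d) :
  scheme kappa h X I_ omega D0 -> countable D0 ->
  (forall x, (forall n, X n (xs x n)) /\ xs x n @[n --> \oo] --> x) ->
  exists nl : nat -> nat, {homo nl : i j / (i < j)%N} /\
    forall g (q : rat) (z : 'rV[rat]_d), D0 g -> 0 <= ratr q :> R ->
      cvgn (fun l => iter (steps h (ratr q) (nl l)) (I_ (nl l)) g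
                          (xs (map_mx ratr z) (nl l))).
Proof.
move=> sc cD0 xsP; have wk := sc_weight sc.
have [g0 [Dg0 _ _]] := sc_D0_dense sc 0 (Ckappa0 kappa setT) ltr01.
have [e [De eP]] := countable_surjection Dg0 cD0.
pose w i n := if unpickle i is Some (m, q, z) then
    if (0 <= ratr q :> R) then
      iter (steps h (ratr q) n) (I_ n) (e m) (xs (map_mx (ratr : rat -> R) z) n)
    else 0
  else 0.
have wM i : exists M, forall n, `|w i n| <= M.
  rewrite /w; case: (unpickle i) => [[[m q] z]|]; last by exists 0 => n; rewrite normr0.
  case q0 : (0 <= ratr q :> R); last by exists 0 => n; rewrite normr0.
  have [Xx xx] := xsP (map_mx ratr z).
  have /cvg_seq_bounded[N [_ HN]] : cvgn (xs (map_mx ratr z)) by apply/cvg_ex; eexists; exact: xx.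
  have [C C0 HC] := wle_nball wk (N + 1).
  have Ee : Ckappa kappa setT (e m) by have [] := sc_D0 sc (De m).
  have r0 := knorm_ge0 setT (e m) (weight_gt0 wk).
  exists (C * (expR (omega * ratr q) * knorm kappa setT (e m))) => n.
  apply: (HC (X n)) (Xx n) _; last by apply: (HN _ _ n I); rewrite ltrDl.
  apply: wle_le (iter_norm sc _ (Ckappa_restrict _ Ee) r0 _) => [|x _].
    by rewrite ler_wpM2r// (ler_expRM (sc_omega sc))// (steps_le sc).
  exact: wle_knorm Ee x I.
have [nl [nlP nlw]] := diagonal_subsequence wM.
exists nl; split => // g q z Dg q0; have [m em] := eP g Dg.
by have := nlw (pickle (m, q, z)); rewrite /w pickleK q0 em.
Qed.

Lemma Lip_b_Ckappa {R : realType} {d : nat} (kappa : 'rV[R]_d -> R)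
    (X : set 'rV[R]_d) f : weight kappa -> Lip_b X f -> Ckappa kappa X f.
Proof.
move=> wk [[L HL] [M HM]]; pose r := Num.max 0 (Num.max L M).
apply: (@Lip_br_Ckappa _ _ _ wk X f r); first by rewrite /r le_max lexx.
split=> [x y Xx Xy|x Xx].
  rewrite (le_trans (HL x y Xx Xy))// ler_wpM2r ?sqrtr_ge0//.
  by rewrite /r !le_max lexx orbT.
by rewrite (le_trans (HM x Xx))// /r !le_max lexx !orbT.
Qed.

(** * Existence of the limit semigroup *)

Theorem theorem2p11 (R : realType) (d : nat) (kappa : 'rV[R]_d -> R)
  (hkappa : weight kappa)
  (h : nat -> R) (h_gt0 : forall n, 0 < h n) (h_to0 : h n @[n --> \oo] --> 0)
  (X : nat -> set 'rV[R]_d)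
  (X_closed : forall n, closed (X n))
  (X_add : forall n (x y : 'rV[R]_d), X n x -> X n y -> X n (x + y))
  (X_dense : forall x : 'rV[R]_d, exists xn : nat -> 'rV[R]_d,
    (forall n, X n (xn n)) /\ xn n @[n --> \oo] --> x)
  (I_ : nat -> ('rV[R]_d -> R) -> 'rV[R]_d -> R)
  (I_operator : forall n, operator_on kappa (X n) (I_ n))
  (* (1) *)
  (I_convex : forall n, convex_op kappa (X n) (I_ n))
  (I_monotone : forall n, monotone_op kappa (X n) (I_ n))
  (I_zero : forall n x, X n x -> I_ n 0 x = 0)
  (* (2) *)
  (omega : R) (omega_ge0 : 0 <= omega)
  (I_lipschitz : forall n f g, Ckappa kappa (X n) f -> Ckappa kappa (X n) g ->
    knorm kappa (X n) (I_ n f - I_ n g) <=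
      expR (omega * h n) * knorm kappa (X n) (f - g))
  (* (3) *)
  (I_local : forall (eps r T : R) (K : set 'rV[R]_d),
    0 < eps -> 0 <= r -> 0 <= T -> compact K ->
    exists (c : R) (K' : set 'rV[R]_d), [/\ 0 <= c, compact K' &
      forall k n f g, k%:R * h n <= T ->
        Cball kappa (X n) r f -> Cball kappa (X n) r g ->
        supnorm (K `&` X n) (iter k (I_ n) f - iter k (I_ n) g) <=
          c * supnorm (K' `&` X n) (f - g) + eps])
  (* (4) *)
  (I_Lip : forall n (r : R) f, 0 <= r -> Lip_br (X n) r f ->
    Lip_br (X n) (expR (omega * h n) * r) (I_ n f))
  (* (5) *)
  (D0_exists : exists D0 : set ('rV[R]_d -> R),
    [/\ countable D0,
        D0 `<=` Lip_b setT,
        forall f, D0 f -> exists (r : R) (fbar : nat -> 'rV[R]_d -> R),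
          [/\ 0 <= r,
              forall n, Lip_br (X n) r (fbar n),
              cvg_along kappa X fbar f,
              forall n, knorm kappa (X n) (fbar n) <= knorm kappa setT f &
              exists g, Ckappa kappa setT g /\
                cvg_along kappa X
                  (fun n => (h n)^-1 *: (I_ n (fbar n) - fbar n)) g] &
        forall f, Ckappa kappa setT f -> exists fn : nat -> 'rV[R]_d -> R,
          [/\ forall n, D0 (fn n), mixed_cvg kappa \oo fn f &
              forall n, knorm kappa setT (fn n) <= knorm kappa setT f]]) :
  exists (S : R -> ('rV[R]_d -> R) -> 'rV[R]_d -> R) (nl : nat -> nat),
    sc_convex_monotone_semigroup kappa S /\
    {homo nl : i j / (i < j)%N} /\
    (forall f (t : R), Ckappa kappa setT f -> 0 <= t ->
      forall (k : nat -> nat) (fn : nat -> 'rV[R]_d -> R),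
        (k n)%:R * h n @[n --> \oo] --> t ->
        (forall n, Ckappa kappa (X n) (fn n)) -> cvg_along kappa X fn f ->
        cvg_along kappa (fun l => X (nl l))
          (fun l => iter (k (nl l)) (I_ (nl l)) (fn (nl l))) (S t f)) /\
    (* (i) *)
    (forall f (fn : nat -> 'rV[R]_d -> R) g, Ckappa kappa setT f ->
      (forall n, Ckappa kappa (X n) (fn n)) -> cvg_along kappa X fn f ->
      Ckappa kappa setT g ->
      cvg_along kappa X (fun n => (h n)^-1 *: (I_ n (fn n) - fn n)) g ->
      generator_dom kappa S f /\ generator kappa S f = g) /\
    (* (ii) *)
    (forall (t : R) f g, 0 <= t -> Ckappa kappa setT f -> Ckappa kappa setT g ->
      knorm kappa setT (S t f - S t g) <=
        expR (omega * t) * knorm kappa setT (f - g)) /\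
    (* (iii) *)
    (forall (eps r T : R) (K : set 'rV[R]_d),
      0 < eps -> 0 <= r -> 0 <= T -> compact K ->
      exists (c : R) (K' : set 'rV[R]_d), [/\ 0 <= c, compact K' &
        forall (t : R) f g, 0 <= t <= T ->
          Cball kappa setT r f -> Cball kappa setT r g ->
          supnorm K (S t f - S t g) <= c * supnorm K' (f - g) + eps]) /\
    (* (iv) *)
    (forall (r t : R) f, 0 <= r -> 0 <= t -> Lip_br setT r f ->
      Lip_br setT (expR (omega * t) * r) (S t f)).
Proof.
have k0 := weight_gt0 hkappa.
have [D0 [cD0 D0L HD0 Hdense]] := D0_exists.
have sc : scheme kappa h X I_ omega D0.
  split => //.
  - move=> n f g b Ef Eg b0 H.
    have EI : Ckappa kappa (X n) (I_ n f - I_ n g).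
      by apply: (CkappaB hkappa); exact: (op_maps (I_operator n)).
    move=> x /(wle_knorm EI)/le_trans; apply.
    rewrite (le_trans (I_lipschitz n f g Ef Eg))// ler_wpM2l ?expR_ge0//.
    exact: knorm_le.
  - move=> eps r T rho e0 r0 T0.
    have [c [K' [c0 cK' H]]] := I_local _ _ _ _ e0 r0 T0 (@compact_nball R d rho).
    have [rho' _ Kr] := compact_sub_nball cK'.
    exists c, rho'; split => // k n f g b kT Ef fr Eg gr b0 fg x Xx xr.
    have Bf : Cball kappa (X n) r f by split => //; exact: knorm_le.
    have Bg : Cball kappa (X n) r g by split => //; exact: knorm_le.
    have EI : Ckappa kappa (X n) (iter k (I_ n) f - iter k (I_ n) g).
      by apply: (CkappaB hkappa); exact: iter_operator.
    have [C C0 HC] := wle_nball hkappa rho.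
    have HI : forall y, (nball rho `&` X n) y ->
        `|(iter k (I_ n) f - iter k (I_ n) g) y| <=
          C * knorm kappa (X n) (iter k (I_ n) f - iter k (I_ n) g).
      by move=> y [yr Xy]; exact: HC (wle_knorm EI) _ Xy yr.
    apply: (le_trans (supnorm_ge HI (conj (xr : nball rho x) Xx))).
    rewrite (le_trans (H k n f g kT Bf Bg))// lerD2r ler_wpM2l//.
    by apply: supnorm_le => // y [/Kr yr Xy]; exact: fg.
  - move=> f Df; have Ef := Lip_b_Ckappa hkappa (D0L f Df); split => //.
    have [r [fb [r0 fbL fbf fbk [g [Eg [[M HM] _]]]]]] := HD0 f Df.
    have Efb n : Ckappa kappa (X n) (fb n) by exact: Lip_br_Ckappa (fbL n).
    have [_ lc] := cvg_along_loc hkappa X_dense Ef Efb fbf.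
    exists r, fb, (Num.max 0 M); split => //; first by rewrite le_max lexx.
    move=> n; split; first by move=> x /(wle_knorm (Efb n))/le_trans; apply.
    have EB : Ckappa kappa (X n) (I_ n (fb n) - fb n).
      by apply: (CkappaB hkappa) => //; exact: (op_maps (I_operator n)).
    move=> x /(wle_knorm (CkappaZ (h n)^-1 EB)).
    rewrite [(_ *: _) x]/((h n)^-1 * (I_ n (fb n) - fb n) x) normrM.
    rewrite gtr0_norm ?invr_gt0// -mulrA ler_pdivrMl// => /le_trans; apply.
    by rewrite ler_wpM2l ?(ltW (h_gt0 n))// le_max HM orbT.
  - move=> f rho eps Ef e0; have [fn [Dfn fnf fnk]] := Hdense f Ef.
    have cK := @compact_nball R d rho.
    have [n [En nf]] := filter_ex (mixed_cvg_supnorm hkappa fnf Ef cK e0).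
    exists (fn n); split => // x xr; rewrite distrC.
    apply: (le_trans _ (ltW nf)).
    exact: (le_supnorm hkappa cK (CkappaB hkappa En Ef) (xr : nball rho x)).
have [xs xsP] := choice X_dense.
have [nl [nlP conv0]] := convergent_subsequence sc cD0 xsP.
have sc' := scheme_subseq sc nlP.
pose ys (x : 'rV[R]_d) l := xs x (nl l).
have xsP' x : (forall l, X (nl l) (ys x l)) /\ ys x l @[l --> \oo] --> x.
  by have [Xx xx] := xsP x; split => //; exact: cvg_subseq nlP _ _ _ xx.
have conv g (q : rat) (z : 'rV[rat]_d) : D0 g -> 0 <= ratr q :> R ->
    cvgn (fun l => iter (steps (fun l => h (nl l)) (ratr q) l) (I_ (nl l)) g
                        (ys (map_mx ratr z) l)).
  exact: conv0.
pose S := St (fun l => h (nl l)) (fun l => I_ (nl l)) ys.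
exists S, nl; split; first by have := St_semigroup sc' xsP' conv.
split=> //; split.
  move=> f t Ef t0 k fn kt Efn fnf.
  have [r af] := bcvg_cvg_along sc Ef Efn fnf.
  have kt' := cvg_subseq nlP kt.
  have [s [s0 _ _ _ us uf]] :=
    St_bcvg sc' xsP' conv (k := fun l => k (nl l)) (bcvg_subseq nlP af) t0 kt'.
  exact: loc_cvg_along s0 us uf.
split.
  move=> f fn g Ef Efn fnf Eg qg.
  have [r ar] := bcvg_cvg_along sc Ef Efn fnf.
  have Eq n : Ckappa kappa (X n) ((h n)^-1 *: (I_ n (fn n) - fn n)).
    by apply: CkappaZ; apply: (CkappaB hkappa) => //; exact: (op_maps (I_operator n)).
  have [s as_] := bcvg_cvg_along sc Eg Eq qg.
  have lim : generator_lim kappa S f g.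
    apply: (generator_limit sc' xsP' conv (r := Num.max r s)).
      by apply: bcvg_weaken (bcvg_subseq nlP ar); rewrite le_max lexx.
    by apply: bcvg_weaken (bcvg_subseq nlP as_); rewrite le_max lexx orbT.
  split; first by split => //; exists g.
  apply: xget_subset1 => // g1 g2 [Eg1 l1] [Eg2 l2].
  exact: (mixed_cvg_unique hkappa _ Eg1 Eg2 l1 l2).
split.
  move=> t f g t0 Ef Eg.
  have b0 := knorm_ge0 setT (f - g) k0.
  apply: knorm_le; first by rewrite mulr_ge0// expR_ge0.
  by apply: (St_wleB sc' xsP' conv) => //; apply: wle_knorm; exact: (CkappaB hkappa).
split.
  move=> eps r T K e0 r0 T0 /compact_sub_nball[rho _ Kr].
  have [c [rho' [c0 H]]] := St_local sc' xsP' conv rho e0 r0 T0.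
  exists c, (nball rho'); split => //; first exact: compact_nball.
  move=> t f g tT [Ef fr] [Eg gr].
  have b0 := supnorm_ge0 (nball rho') (f - g).
  apply: supnorm_le; first by rewrite addr_ge0 ?(ltW e0)// mulr_ge0.
  move=> x /Kr xr; apply: H => //.
  - by move=> y /(wle_knorm Ef)/le_trans; apply.
  - by move=> y /(wle_knorm Eg)/le_trans; apply.
  - move=> y yr; apply: (le_supnorm hkappa (@compact_nball R d rho')) => //.
    exact: (CkappaB hkappa).
by move=> r t f; exact: (St_Lip sc' xsP' conv).
Qed.
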